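(* Let $p\ge 0$ and $m\ge 0$ be integers and let $z$ be a real number with $0<|z|<1$. Then $$\sum_{n=1}^{\infty} \frac{\zeta(2n+1)z^{2n}}{(2n+2)\cdots(2n+m+2)(2n+m+p+3)}= (p+m+2)\bigg((-1)^{m+1}p!\sum_{k=m+3}^{p+m+3}\frac{\pi\,(-1)^{\lfloor \frac{k}{2} \rfloor}\,\mathrm{Cl}_{k}(2\pi z)}{(p+m+3-k)!\,(2\pi z)^k}$$ $$\qquad-\delta_{\lfloor \frac{p+m}{2} \rfloor, \frac{p+m}{2}}\frac{p!\,(-1)^{\frac{p+m}{2}}(-1)^m\,\zeta(p+m+3)}{2z\,(2\pi z)^{m+p+2}}+\sum_{k=0}^{p} \frac{p!\,(-1)^k\,\psi^{(-k-m-3)}(z)}{(p-k)!\,z^{k+m+3}}\bigg)-\frac{\gamma}{(m+2)!\,(p+m+3)}-\frac{1}{2z\,(m+1)!\,(p+m+2)}$$ $$\qquad+\frac{(-1)^{\lfloor \frac{m+1}{2} \rfloor}\,\mathrm{Cl}_{m+2}(2\pi z)}{2z\,(2\pi z)^{m+1}}-\frac{\psi^{(-m-2)}(z)}{z^{m+2}}+\sum_{k=1}^{\lfloor \frac{m+1}{2} \rfloor} \frac{k(-1)^k\,\zeta(2k+1)}{z\,(2\pi z)^{2k}\,(m+1-2k)!\,(m+p+2-2k)}.$$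
   Context: The denominator on the left is $\prod_{i=2}^{m+2}(2n+i)\cdot(2n+m+p+3)$. The negapolygammas are, for $n\ge2$, $\psi^{(-n)}(z)=\frac{1}{(n-2)!}\int_0^z (z-t)^{n-2}\log\Gamma(t)\,dt$; for $t\in(-1,0)$, $\log\Gamma(t)$ is read as $\log|\Gamma(t)|$. The generalized Clausen functions of a real variable $\theta$ are $\mathrm{Cl}_{2j}(\theta)=\sum_{k=1}^\infty \frac{\sin(k\theta)}{k^{2j}}$ for $j\ge1$ and $\mathrm{Cl}_{2j+1}(\theta)=\sum_{k=1}^\infty \frac{\cos(k\theta)}{k^{2j+1}}$ for $j\ge0$. $\zeta$ is the Riemann zeta function and $\gamma$ is the Euler–Mascheroni constant. $\delta_{a,b}$ is the Kronecker delta, so $\delta_{\lfloor n/2\rfloor,n/2}$ is $1$ if $n$ is even and $0$ if $n$ is odd; a term multiplied by it is read as $0$ when $n$ is odd. Empty sums are $0$. *)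

(* Defs.v *)
From Stdlib Require Import Reals Lra Lia Arith ZArith.
From Coquelicot Require Import Coquelicot.
Open Scope R_scope.

Definition euler_gamma_integral (x : R) : R :=
  RInt_gen (fun t => Rpower t (x - 1) * exp (- t))
           (at_right 0) (Rbar_locally p_infty).

Fixpoint gamma_shift (n : nat) (x : R) : R :=
  match n with
  | O => euler_gamma_integral x
  | S n' => gamma_shift n' (x + 1) / x
  end.

(* The real Gamma function: Euler's integral for x > 0 (there up (- x) <= 0, so
   no shift takes place), continued to x < 0 by Gamma x = Gamma (x + 1) / x,
   applied the least number of times that makes the argument positive.  The
   value at the poles 0, -1, -2, ... is irrelevant. *)
Definition Gamma (x : R) : R := gamma_shift (Z.to_nat (up (- x))) x.

(* log |Gamma|, which is log Gamma on the positive reals. *)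
Definition logGamma (t : R) : R := ln (Rabs (Gamma t)).

(* The side from which the lower endpoint 0 of an integral from 0 to z is
   approached: the integrands below have a logarithmic singularity at 0, so
   that the integrals are improper there. *)
Definition endpoint0 (z : R) : (R -> Prop) -> Prop :=
  if Rlt_dec 0 z then at_right 0 else at_left 0.

(* [negapolygamma n z] is psi^(-n) (z), for n >= 2.  The integral is oriented:
   for z < 0 it is minus the integral over [z, 0]. *)
Definition negapolygamma (n : nat) (z : R) : R :=
  / INR (fact (n - 2)) *
  RInt_gen (fun t => (z - t) ^ (n - 2) * logGamma t)
           (endpoint0 z) (at_point z).

Definition Clausen (n : nat) (theta : R) : R :=
  Series (fun k => (if Nat.even n then sin (INR (S k) * theta)
                    else cos (INR (S k) * theta)) / INR (S k) ^ n).

(* The Riemann zeta function at the integers s >= 2. *)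
Definition zeta (s : nat) : R := Series (fun k => / INR (S k) ^ s).

Definition euler_mascheroni : R :=
  real (Lim_seq (fun n => sum_n_m (fun k => / INR k) 1 n - ln (INR n))).

(* Note that prod_f_R0 f m is the product of f 0, ..., f m, with m + 1 factors:
   this is (2n+2) (2n+3) ... (2n+m+2) (2n+m+p+3). *)
Definition zeta_series_den (p m n : nat) : R :=
  prod_f_R0 (fun i => INR (2 * n + 2 + i)) m * INR (2 * n + m + p + 3).

(* Main.v *)
Require Import Defs.
From Stdlib Require Import Reals Lra Lia Arith ZArith.
From Coquelicot Require Import Coquelicot.
Open Scope R_scope.

(** Let S be the odd power series with coefficients zeta(N) / N, N = 2n+1 >= 3.
    Everything follows from one identity: for 0 < |t| < 1,

      log |Gamma t| = - gamma t - S(t) + log(2 pi) / 2 - log |t| / 2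
                      - log |2 sin (pi t)| / 2.

    It comes from Gauss's product for Gamma ([logGamma_product]).  In the
    logarithm of that product the even part in t is a sum of log (1 - t^2 / k^2),
    which is Euler's sine product ([ln_sine_product]); the odd part is a double
    series which becomes S once the two summations are interchanged
    ([sum_artanh_lim], [logGamma_expansion]).

    Integrating the identity j times from 0 turns each term into an object of
    the theorem.  The left-hand side becomes the negapolygamma of index j + 1,
    by repeated integration by parts ([negapolygamma_chain]).  The logarithm of
    the sine becomes the Clausen function of index j + 1, because
    - log (2 sin (x / 2)) is the derivative of the second Clausen function
    ([is_derive_Clausen_2]); the odd Clausen functions do not vanish at 0, and
    the integration constants form a polynomial whose coefficients are odd
    zeta values.  The logarithm of |t| produces harmonic numbers.  Solving for
    the j-fold integral of S gives [odd_zeta_series_closed_form].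

    The rest is linear algebra over the index j.  The j-fold integral of S has
    coefficients zeta(N) (N-1)! / (N+j)!, and there is a linear functional on
    sequences indexed by j, [weight], which sends N! / (N+j)! to the coefficient
    N N! / ((N+m+1)! (N+m+p+2)) of the theorem, for every N >= 0.  Applied to
    the j-fold integrals of S it gives the series; it remains to apply it to the
    closed form.  The term in gamma behaves like N = 1.  The constants log (2 pi)
    and log |z| correspond to N = 0 and disappear.  The harmonic numbers are a
    derivative in N at N = 0 and leave the term without transcendental factor.
    A zeta value zeta(2i+1) comes with the sequence 1 / (j-2i)!, that is
    N = - 2i; this gives the last sum of the theorem as long as 2i <= m+1, and 0
    beyond, except for 2i = p+m+2, where N+m+p+2 vanishes: this exception is the
    Kronecker delta term. *)

(** * Termwise differentiation of series *)

(** Equalities inherited from a normed module are read back in the reals, where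
    [ring] and [field] apply. *)
Ltac eq_real := match goal with |- ?a = ?b => change (@eq R a b) end.

Lemma Series_tail_le (a M : nat -> R) (n : nat) :
  ex_series M -> (forall k, Rabs (a k) <= M k) ->
  Rabs (Series a - sum_n a n) <= Series M - sum_n M n.
Proof.
  intros HM H.
  assert (Ha : ex_series a) by (apply (ex_series_le a M); assumption).
  rewrite (Series_incr_n a (S n)), (Series_incr_n M (S n)) by (assumption || lia).
  rewrite !sum_n_Reals; simpl pred.
  replace (_ + _ - _) with (Series (fun k => a (S n + k)%nat)) by ring.
  replace (_ + _ - _) with (Series (fun k => M (S n + k)%nat)) by ring.
  assert (HM' : ex_series (fun k => M (S n + k)%nat)) by (apply ex_series_incr_n; assumption).
  eapply Rle_trans; [apply Series_Rabs | apply Series_le; [|assumption]].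
  - apply (ex_series_le (V := R_CompleteNormedModule) _ (fun k => M (S n + k)%nat));
      [intros k|assumption].
    change (norm (Rabs (a (S n + k)%nat))) with (Rabs (Rabs (a (S n + k)%nat))).
    rewrite Rabs_Rabsolu; apply H.
  - intros k; split; [apply Rabs_pos | apply H].
Qed.

Lemma Series_partial_lim (a : nat -> R) :
  ex_series a -> is_lim_seq (sum_n a) (Series a).
Proof. intros H; apply Series_correct, H. Qed.

(** The Weierstrass M-test. *)
Lemma Weierstrass_CVU (f : nat -> R -> R) (M : nat -> R) (c : R) (r : posreal) :
  ex_series M -> (forall n y, Boule c r y -> Rabs (f n y) <= M n) ->
  CVU (fun n y => sum_n (fun k => f k y) n) (fun y => Series (fun k => f k y)) c r.
Proof.
  intros HM H eps Heps.
  destruct (proj2 (is_lim_seq_spec _ _) (Series_partial_lim M HM) (mkposreal eps Heps))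
    as [N HN]; simpl in HN.
  exists N; intros n y Hn Hy.
  eapply Rle_lt_trans; [apply (Series_tail_le _ M)|]; auto.
  specialize (HN n Hn); apply Rabs_def2 in HN; lra.
Qed.

Lemma is_lim_seq_Un_cv (u : nat -> R) (l : R) : is_lim_seq u l -> Un_cv u l.
Proof. apply is_lim_seq_Reals. Qed.

Lemma Series_derive (f f' : nat -> R -> R) (M : nat -> R) (c : R) (r : posreal) (x : R) :
  Boule c r x -> ex_series M ->
  (forall n y, Boule c r y -> Rabs (f' n y) <= M n) ->
  (forall n y, Boule c r y -> is_derive (f n) y (f' n y)) ->
  (forall y, Boule c r y -> ex_series (fun n => f n y)) ->
  is_derive (fun y => Series (fun n => f n y)) x (Series (fun n => f' n x)).
Proof.
  intros Hx HM Hb Hd Hs.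
  apply is_derive_Reals.
  apply (CVU_derivable (fun n y => sum_n (fun k => f k y) n)
           (fun n y => sum_n (fun k => f' k y) n) _
           (fun y => Series (fun n => f' n y)) c r); [| | |assumption].
  - apply Weierstrass_CVU with M; assumption.
  - intros y Hy; apply is_lim_seq_Un_cv, Series_partial_lim, Hs, Hy.
  - intros n y Hy; apply is_derive_Reals.
    apply (is_derive_sum_n (fun k => f k)); intros k _; apply Hd, Hy.
Qed.

Lemma Series_continuous (f : nat -> R -> R) (M : nat -> R) (c : R) (r : posreal) (x : R) :
  Boule c r x -> ex_series M ->
  (forall n y, Boule c r y -> Rabs (f n y) <= M n) ->
  (forall n y, Boule c r y -> continuous (f n) y) ->
  continuous (fun y => Series (fun n => f n y)) x.
Proof.
  intros Hx HM Hb Hc.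
  apply continuity_pt_filterlim.
  apply (CVU_continuity (fun n y => sum_n (fun k => f k y) n) _ c r); [| |assumption].
  - apply Weierstrass_CVU with M; assumption.
  - intros n y Hy; apply continuity_pt_filterlim.
    induction n as [|n IH].
    + apply (continuous_ext (f 0%nat)); [intros z; now rewrite sum_O | now apply Hc].
    + apply (continuous_ext (fun z => plus (sum_n (fun k => f k z) n) (f (S n) z)));
        [intros z; now rewrite sum_Sn|].
      apply @continuous_plus; [exact IH | now apply Hc].
Qed.

Lemma INR_S_pos (k : nat) : 0 < INR (S k).
Proof. apply lt_0_INR; lia. Qed.

Lemma is_lim_seq_inv_INR : is_lim_seq (fun n => / INR n) 0.
Proof.
  replace (Finite 0) with (Rbar_inv p_infty) by reflexivity.
  apply is_lim_seq_inv; [apply is_lim_seq_INR | discriminate].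
Qed.

(** The partial sums telescope; twice this series dominates the series of inverse
    powers. *)
Lemma ex_series_telescope : ex_series (fun k => / (INR (S k) * INR (S (S k)))).
Proof.
  exists 1.
  assert (H : is_lim_seq (fun n => 1 - / INR (S (S n))) (1 - 0)).
  { apply is_lim_seq_minus'; [apply is_lim_seq_const|].
    apply (proj1 (is_lim_seq_incr_1 (fun n => / INR (S n)) 0)).
    apply (proj1 (is_lim_seq_incr_1 (fun n => / INR n) 0)), is_lim_seq_inv_INR. }
  rewrite Rminus_0_r in H.
  apply (filterlim_ext (fun n => 1 - / INR (S (S n)))); [|exact H].
  induction x as [|n IH].
  - rewrite sum_O; simpl; lra.
  - rewrite sum_Sn, <- IH; change plus with Rplus.
    pose proof (INR_S_pos n). rewrite !S_INR in *. field. lra.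
Qed.

Lemma ex_series_inv_pow (s : nat) : (2 <= s)%nat -> ex_series (fun k => / INR (S k) ^ s).
Proof.
  intros Hs.
  apply (ex_series_le (V := R_CompleteNormedModule) _
           (fun k => 2 * / (INR (S k) * INR (S (S k))))).
  - intros k.
    change (Rabs (/ INR (S k) ^ s) <= 2 * / (INR (S k) * INR (S (S k)))).
    pose proof (INR_S_pos k) as H.
    assert (H1 : 1 <= INR (S k)) by (rewrite S_INR; pose proof (pos_INR k); lra).
    rewrite Rabs_pos_eq by (left; apply Rinv_0_lt_compat, pow_lt, H).
    apply Rle_trans with (/ (INR (S k) ^ 2)).
    + apply Rinv_le_contravar; [apply pow_lt, H | apply Rle_pow; [exact H1 | lia]].
    + assert (H2 : INR (S (S k)) = INR (S k) + 1) by apply S_INR.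
      rewrite H2. generalize dependent (INR (S k)); intros x; intros.
      apply (Rmult_le_reg_r (x ^ 2 * (x + 1))); [nra|].
      field_simplify; nra.
  - apply (ex_series_scal_l (V := R_NormedModule) 2 (fun k => / (INR (S k) * INR (S (S k))))), ex_series_telescope.
Qed.

Lemma ex_series_geom_pos (q : R) : 0 <= q < 1 -> ex_series (fun n => q ^ n).
Proof. intros; apply ex_series_geom. rewrite Rabs_pos_eq; lra. Qed.

Lemma zeta_pos (s : nat) : (2 <= s)%nat -> 0 <= zeta s.
Proof.
  intros Hs. unfold zeta.
  rewrite <- (Rmult_0_l (Series (fun k => / INR (S k) ^ s))), <- Series_scal_l.
  apply Series_le; [|now apply ex_series_inv_pow].
  intros n. pose proof (pow_lt _ s (INR_S_pos n)). 
  assert (0 < / INR (S n) ^ s) by now apply Rinv_0_lt_compat. lra.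
Qed.

Lemma inv_pow_le (s s' k : nat) : (s' <= s)%nat -> / INR (S k) ^ s <= / INR (S k) ^ s'.
Proof.
  intros; apply Rinv_le_contravar; [apply pow_lt, INR_S_pos | apply Rle_pow; [|assumption]].
  rewrite S_INR; pose proof (pos_INR k); lra.
Qed.

Lemma zeta_le (s s' : nat) : (2 <= s')%nat -> (s' <= s)%nat -> zeta s <= zeta s'.
Proof.
  intros H2 H. apply Series_le; [|now apply ex_series_inv_pow].
  intros n; split; [left; apply Rinv_0_lt_compat, pow_lt, INR_S_pos | now apply inv_pow_le].
Qed.

Lemma ex_derive_continuity_pt (f : R -> R) (x : R) : ex_derive f x -> continuity_pt f x.
Proof. intros H. apply derivable_continuous_pt, ex_derive_Reals_0, H. Qed.

Lemma ex_derive_continuous_R (f : R -> R) (x : R) : ex_derive f x -> continuous f x.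
Proof. apply (@ex_derive_continuous R_AbsRing R_NormedModule). Qed.

(** * The Euler integral *)

(** The fundamental theorem of calculus when both endpoints are limits. *)
Lemma is_RInt_gen_antiderivative (Fa Fb : (R -> Prop) -> Prop) {FFa : Filter Fa}
  {FFb : Filter Fb} (f G : R -> R) (la lb : R) :
  filter_prod Fa Fb (fun ab => forall x, Rmin (fst ab) (snd ab) <= x <= Rmax (fst ab) (snd ab) ->
                       is_derive G x (f x) /\ continuous f x) ->
  filterlim G Fa (locally la) -> filterlim G Fb (locally lb) ->
  is_RInt_gen f Fa Fb (lb - la).
Proof.
  intros H Ha Hb. unfold is_RInt_gen.
  apply (filterlimi_lim_ext_loc (fun ab => minus (G (snd ab)) (G (fst ab)))).
  - revert H; apply filter_imp; intros [a b] H.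
    apply (is_RInt_derive (V := R_CompleteNormedModule)); intros x Hx; apply H, Hx.
  - unfold minus.
    eapply (filterlim_comp_2 (G := locally lb) (H := locally (opp la))).
    + eapply filterlim_comp; [apply filterlim_snd | exact Hb].
    + eapply filterlim_comp; [|apply (filterlim_opp (V := R_NormedModule))].
      eapply filterlim_comp; [apply filterlim_fst | exact Ha].
    + apply (filterlim_plus (V := R_NormedModule)).
Qed.

Lemma filter_prod_half_line (P : R * R -> Prop) :
  (forall a b, 0 < a -> a <= b -> P (a, b)) ->
  filter_prod (at_right 0) (Rbar_locally p_infty) P.
Proof.
  intros H. exists (fun a => 0 < a < 1) (fun b => 1 < b).
  - exists (mkposreal 1 Rlt_0_1). intros y Hy Hy0.
    change (Rabs (y - 0) < 1) in Hy. rewrite Rminus_0_r, Rabs_pos_eq in Hy; lra.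
  - exists 1; auto.
  - intros a b Ha Hb; apply H; lra.
Qed.

(** The integrals over compact intervals increase with the interval, so that
    they converge to their supremum. *)
Lemma ex_RInt_gen_bounded (f : R -> R) (K : R) :
  (forall t, 0 < t -> continuous f t) -> (forall t, 0 < t -> 0 <= f t) ->
  (forall a b, 0 < a -> a <= b -> RInt f a b <= K) ->
  ex_RInt_gen f (at_right 0) (Rbar_locally p_infty).
Proof.
  intros Hc Hp HK.
  assert (Hex : forall a b, 0 < a -> a <= b -> ex_RInt f a b).
  { intros a b Ha Hab. apply (ex_RInt_continuous (V := R_CompleteNormedModule)).
    intros z; rewrite Rmin_left by assumption; intros Hz; apply Hc; lra. }
  destruct (completeness (fun v => exists a b, 0 < a /\ a <= b /\ v = RInt f a b)) as [l [Hl1 Hl2]].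
  - exists K. intros v (a & b & Ha & Hab & ->). now apply HK.
  - exists (RInt f 1 1), 1, 1. repeat split; lra.
  - exists l. apply filterlimi_locally.
    intros eps.
    assert (Hex' : exists a b, 0 < a /\ a <= b /\ l - eps < RInt f a b).
    { apply Classical_Prop.NNPP. intros Hn.
      assert (l <= l - eps); [|pose proof (cond_pos eps); lra].
      apply Hl2. intros v (a & b & Ha & Hab & ->).
      apply Rnot_lt_le. intros Hlt. apply Hn. exists a, b; auto. }
    destruct Hex' as (a0 & b0 & Ha0 & Hab0 & Hlt).
    exists (fun a => 0 < a < a0) (fun b => b0 < b).
    + exists (mkposreal a0 Ha0). intros y Hy Hy0.
      change (Rabs (y - 0) < a0) in Hy. rewrite Rminus_0_r, Rabs_pos_eq in Hy; lra.
    + exists b0; auto.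
    + intros a b Ha Hb. exists (RInt f a b). split.
      * apply (RInt_correct (V := R_CompleteNormedModule)), Hex; lra.
      * assert (H1 : RInt f a b <= l) by (apply Hl1; exists a, b; repeat split; lra).
        assert (H2 : RInt f a0 b0 <= RInt f a b).
        { rewrite <- (RInt_Chasles f a a0 b) by (apply Hex; lra).
          rewrite <- (RInt_Chasles f a0 b0 b) by (apply Hex; lra).
          assert (0 <= RInt f a a0) by (apply RInt_ge_0; [lra| apply Hex; lra | intros; apply Hp; lra]).
          assert (0 <= RInt f b0 b) by (apply RInt_ge_0; [lra| apply Hex; lra | intros; apply Hp; lra]).
          change (RInt f a0 b0 <= RInt f a a0 + (RInt f a0 b0 + RInt f b0 b)). lra. }
        change (Rabs (RInt f a b - l) < eps). apply Rabs_def1; lra.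
Qed.

Definition gamma_integrand (x t : R) : R := Rpower t (x - 1) * exp (- t).

Lemma Rpower_pos (x y : R) : 0 < Rpower x y.
Proof. apply exp_pos. Qed.

Lemma ln_le_sub_1 (u : R) : 0 < u -> ln u <= u - 1.
Proof. intros Hu. pose proof (exp_ineq1_le (ln u)) as H. rewrite exp_ln in H; lra. Qed.

(** The maximum over t of y log (1 + t) - t is attained at t = y - 1; the tangent
    inequality log u <= u - 1 at u = (1 + t) / y proves it without calculus. *)
Lemma Rpower_exp_bound (y t : R) : 0 < y -> 0 < t ->
  Rpower (1 + t) y * exp (- t) <= exp (1 - y + y * ln y).
Proof.
  intros Hy Ht. unfold Rpower. rewrite <- exp_plus.
  assert (y * ln (1 + t) + - t <= 1 - y + y * ln y) as H.
  { assert (H : ln ((1 + t) / y) <= (1 + t) / y - 1)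
      by (apply ln_le_sub_1, Rdiv_lt_0_compat; lra).
    rewrite ln_div in H by lra.
    apply (Rmult_le_compat_l y) in H; [|lra].
    replace (y * ((1 + t) / y - 1)) with (1 + t - y) in H by (field; lra). lra. }
  destruct H as [H| ->]; [left; now apply exp_increasing | lra].
Qed.

Lemma gamma_integrand_continuous (x t : R) : 0 < t -> continuous (gamma_integrand x) t.
Proof.
  intros Ht. apply ex_derive_continuous_R. unfold gamma_integrand, Rpower.
  auto_derive; assumption.
Qed.

Lemma gamma_integrand_pos (x t : R) : 0 < gamma_integrand x t.
Proof. apply Rmult_lt_0_compat; [apply Rpower_pos | apply exp_pos]. Qed.

(** The integrand is dominated by the derivative of a multiple of the bounded
    function (t / (1 + t)) ^ x. *)
Lemma ex_gamma_integral (x : R) : 0 < x ->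
  ex_RInt_gen (gamma_integrand x) (at_right 0) (Rbar_locally p_infty).
Proof.
  intros Hx.
  (* K bounds (1 + t) ^ (x + 1) exp (- t), so that g, the derivative of G,
     dominates the integrand. *)
  set (K := exp (1 - (x + 1) + (x + 1) * ln (x + 1))).
  assert (HK : 0 < K) by apply exp_pos.
  set (G := fun t => K / x * exp (x * (ln t - ln (1 + t)))).
  set (g := fun t => K * (exp (x * (ln t - ln (1 + t))) * (/ t - / (1 + t)))).
  apply (ex_RInt_gen_bounded _ (K / x)).
  - intros; now apply gamma_integrand_continuous.
  - intros; left; apply gamma_integrand_pos.
  - intros a b Ha Hab.
    assert (Hg : forall t, 0 < t -> continuous g t).
    { intros t Ht. apply ex_derive_continuous_R. unfold g. auto_derive. repeat split; lra. }
    assert (HI : is_RInt g a b (minus (G b) (G a))).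
    { apply (is_RInt_derive (V := R_CompleteNormedModule) G).
      - intros t; rewrite Rmin_left by assumption; intros Ht.
        unfold G, g. auto_derive; [repeat split; lra|].
        change (ln t + - ln (1 + t)) with (ln t - ln (1 + t)). field. repeat split; lra.
      - intros t; rewrite Rmin_left by assumption; intros Ht. apply Hg; lra. }
    apply Rle_trans with (RInt g a b).
    + apply RInt_le; [assumption| | |].
      * apply (ex_RInt_continuous (V := R_CompleteNormedModule)).
        intros t; rewrite Rmin_left by assumption; intros Ht.
        apply gamma_integrand_continuous; lra.
      * eexists; exact HI.
      * intros t Ht. assert (Ht0 : 0 < t) by lra.
        pose proof (Rpower_exp_bound (x + 1) t ltac:(lra) Ht0) as Hb. fold K in Hb.
        unfold gamma_integrand, g.
        assert (E1 : Rpower t (x - 1) = exp (x * ln t) / t).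
        { unfold Rpower, Rdiv. rewrite Rmult_minus_distr_r, Rmult_1_l.
          unfold Rminus. rewrite exp_plus, exp_Ropp, exp_ln by assumption. reflexivity. }
        assert (E2 : exp (x * (ln t - ln (1 + t))) * (/ t - / (1 + t))
                     = exp (x * ln t) / t * / Rpower (1 + t) (x + 1)).
        { unfold Rpower. rewrite Rmult_plus_distr_r, Rmult_1_l, exp_plus, (exp_ln (1 + t)) by lra.
          replace (x * (ln t - ln (1 + t))) with (x * ln t + - (x * ln (1 + t))) by ring.
          rewrite exp_plus, exp_Ropp.
          field. repeat split; try lra. apply Rgt_not_eq, exp_pos. }
        rewrite E1, E2.
        replace (K * (exp (x * ln t) / t * / Rpower (1 + t) (x + 1)))
          with (exp (x * ln t) / t * (K * / Rpower (1 + t) (x + 1))) by ring.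
        apply Rmult_le_compat_l.
        { left; apply Rdiv_lt_0_compat; [apply exp_pos | assumption]. }
        pose proof (Rpower_pos (1 + t) (x + 1)) as Hp.
        apply (Rmult_le_reg_l (Rpower (1 + t) (x + 1))); [assumption|].
        replace (Rpower (1 + t) (x + 1) * (K * / Rpower (1 + t) (x + 1))) with K; [assumption|].
        field; lra.
    + rewrite (is_RInt_unique (V := R_CompleteNormedModule) _ _ _ _ HI).
      change (G b - G a <= K / x).
      assert (0 < G a).
      { apply Rmult_lt_0_compat; [apply Rdiv_lt_0_compat; assumption | apply exp_pos]. }
      assert (G b <= K / x * 1); [|lra].
      apply Rmult_le_compat_l; [left; apply Rdiv_lt_0_compat; assumption|].
      apply Rle_trans with (exp 0); [left; apply exp_increasing | rewrite exp_0; lra].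
      assert (ln b < ln (1 + b)) by (apply ln_increasing; lra). nra.
Qed.

Lemma gamma_integral_correct (x : R) : 0 < x ->
  is_RInt_gen (gamma_integrand x) (at_right 0) (Rbar_locally p_infty) (euler_gamma_integral x).
Proof.
  intros Hx. apply (RInt_gen_correct (V := R_CompleteNormedModule)); now apply ex_gamma_integral.
Qed.

Lemma gamma_integral_unique (x l : R) :
  is_RInt_gen (gamma_integrand x) (at_right 0) (Rbar_locally p_infty) l ->
  euler_gamma_integral x = l.
Proof.
  intros H. exact (is_RInt_gen_unique (V := R_CompleteNormedModule) (gamma_integrand x) l H).
Qed.

Lemma is_lim_at_right (f : R -> R) (l : R) :
  (forall eps, 0 < eps -> exists d, 0 < d /\ forall t, 0 < t < d -> Rabs (f t - l) < eps) ->
  filterlim f (at_right 0) (locally l).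
Proof.
  intros H. apply filterlim_locally. intros eps.
  destruct (H eps (cond_pos eps)) as (d & Hd & Hf).
  exists (mkposreal d Hd). intros y Hy Hy0. apply Hf.
  change (Rabs (y - 0) < d) in Hy. rewrite Rminus_0_r, Rabs_pos_eq in Hy; lra.
Qed.

Lemma is_lim_infty (f : R -> R) (l : R) :
  (forall eps, 0 < eps -> exists M, forall t, M < t -> Rabs (f t - l) < eps) ->
  filterlim f (Rbar_locally p_infty) (locally l).
Proof.
  intros H. apply filterlim_locally. intros eps.
  destruct (H eps (cond_pos eps)) as (M & HM). exists M. exact HM.
Qed.

Lemma euler_gamma_1 : euler_gamma_integral 1 = 1.
Proof.
  apply gamma_integral_unique.
  replace 1 with (0 - - 1) at 2 by ring.
  apply (is_RInt_gen_antiderivative _ _ _ (fun t => - exp (- t))).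
  - apply filter_prod_half_line. intros a b Ha Hab t; simpl.
    rewrite Rmin_left by assumption; intros Ht.
    split; [|apply gamma_integrand_continuous; lra].
    unfold gamma_integrand. rewrite Rminus_diag, Rpower_O by lra.
    auto_derive; trivial. ring.
  - eapply filterlim_filter_le_1; [apply filter_le_within|].
    replace (- 1) with (- exp (- 0)) by (rewrite Ropp_0, exp_0; ring).
    apply (ex_derive_continuous_R (fun t => - exp (- t))). auto_derive; trivial.
  - apply is_lim_infty. intros eps Heps. exists (- ln eps). intros t Ht.
    rewrite Rminus_0_r, Rabs_Ropp, Rabs_pos_eq by (left; apply exp_pos).
    rewrite <- (exp_ln eps) by assumption. apply exp_increasing; lra.
Qed.

(** Integration by parts: t ^ x exp (- t) vanishes at both ends. *)
Lemma euler_gamma_succ (x : R) : 0 < x ->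
  euler_gamma_integral (x + 1) = x * euler_gamma_integral x.
Proof.
  intros Hx.
  assert (H : is_RInt_gen (fun t => gamma_integrand (x + 1) t - x * gamma_integrand x t)
                (at_right 0) (Rbar_locally p_infty) (0 - 0)).
  { apply (is_RInt_gen_antiderivative _ _ _ (fun t => - (Rpower t x * exp (- t)))).
    - apply filter_prod_half_line. intros a b Ha Hab t; simpl.
      rewrite Rmin_left by assumption; intros Ht.
      assert (Ht0 : 0 < t) by lra. split.
      + unfold gamma_integrand, Rpower. auto_derive; [assumption|].
        replace (x + 1 - 1) with x by ring. replace ((x - 1) * ln t) with (x * ln t + - ln t) by ring.
        rewrite exp_plus, (exp_Ropp (ln t)), exp_ln by assumption.
        field; lra.
      + apply ex_derive_continuous_R. unfold gamma_integrand, Rpower. auto_derive; tauto.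
    - apply is_lim_at_right. intros eps Heps.
      exists (Rpower eps (/ x)). split; [apply Rpower_pos|]. intros t Ht.
      rewrite Rminus_0_r, Rabs_Ropp, Rabs_pos_eq
        by (left; apply Rmult_lt_0_compat; [apply Rpower_pos | apply exp_pos]).
      assert (H1 : exp (- t) <= 1) by (rewrite <- exp_0; left; apply exp_increasing; lra).
      assert (H2 : Rpower t x < eps).
      { replace eps with (Rpower (Rpower eps (/ x)) x).
        - apply Rlt_Rpower_l; lra.
        - rewrite Rpower_mult, Rinv_l, Rpower_1; lra. }
      pose proof (Rpower_pos t x). pose proof (exp_pos (- t)). nra.
    - set (K := exp (1 - (x + 1) + (x + 1) * ln (x + 1))).
      apply is_lim_infty. intros eps Heps. exists (Rmax 0 (K / eps)). intros t Ht.
      assert (Ht0 : 0 < t) by (eapply Rle_lt_trans; [apply Rmax_l | exact Ht]).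
      assert (Ht1 : K / eps < t) by (eapply Rle_lt_trans; [apply Rmax_r | exact Ht]).
      rewrite Rminus_0_r, Rabs_Ropp, Rabs_pos_eq
        by (left; apply Rmult_lt_0_compat; [apply Rpower_pos | apply exp_pos]).
      pose proof (Rpower_exp_bound (x + 1) t ltac:(lra) Ht0) as Hb. fold K in Hb.
      rewrite Rpower_plus, Rpower_1 in Hb by lra.
      assert (H1 : Rpower t x <= Rpower (1 + t) x) by (apply Rle_Rpower_l; lra).
      pose proof (exp_pos (- t)) as He. pose proof (Rpower_pos t x) as Hp.
      apply (Rmult_lt_reg_l t); [assumption|].
      apply Rle_lt_trans with K.
      + eapply Rle_trans; [|exact Hb].
        rewrite <- Rmult_assoc. apply Rmult_le_compat_r; [lra|]. nra.
      + apply (Rmult_lt_compat_r eps) in Ht1; [|assumption].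
        unfold Rdiv in Ht1. rewrite Rmult_assoc, Rinv_l in Ht1 by lra. lra. }
  assert (H' : is_RInt_gen (fun t => gamma_integrand (x + 1) t - x * gamma_integrand x t)
                (at_right 0) (Rbar_locally p_infty)
                (euler_gamma_integral (x + 1) - x * euler_gamma_integral x)).
  { apply (is_RInt_gen_minus (V := R_NormedModule) (gamma_integrand (x + 1))
             (fun t => x * gamma_integrand x t)).
    - apply gamma_integral_correct; lra.
    - apply (is_RInt_gen_scal (V := R_NormedModule)), gamma_integral_correct; assumption. }
  assert (E : euler_gamma_integral (x + 1) - x * euler_gamma_integral x = 0 - 0).
  { rewrite <- (is_RInt_gen_unique (V := R_CompleteNormedModule) _ _ H).
    exact (eq_sym (is_RInt_gen_unique (V := R_CompleteNormedModule) _ _ H')). }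
  lra.
Qed.

(** * Gauss's product *)

(** Convexity of the exponential: the tangent at s log u lies below the values
    at log u and at 0. *)
Lemma Rpower_Bernoulli (u s : R) : 0 < u -> 0 <= s <= 1 -> Rpower u s <= 1 - s + s * u.
Proof.
  intros Hu Hs. unfold Rpower. set (a := ln u). rewrite <- (exp_ln u Hu) at 1. fold a.
  pose proof (exp_ineq1_le (a - s * a)) as H1. pose proof (exp_ineq1_le (- (s * a))) as H2.
  pose proof (exp_pos (s * a)) as Hp.
  assert (E1 : exp (a - s * a) * exp (s * a) = exp a) by (rewrite <- exp_plus; f_equal; ring).
  assert (E2 : exp (- (s * a)) * exp (s * a) = 1)
    by (rewrite <- exp_plus, <- exp_0; f_equal; ring).
  assert (H : 1 <= s * exp (a - s * a) + (1 - s) * exp (- (s * a))).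
  { apply Rle_trans with (s * (1 + (a - s * a)) + (1 - s) * (1 + - (s * a))); [right; ring|].
    apply Rplus_le_compat; apply Rmult_le_compat_l; lra. }
  apply (Rmult_le_compat_r (exp (s * a))) in H; [|lra].
  apply Rle_trans with ((s * exp (a - s * a) + (1 - s) * exp (- (s * a))) * exp (s * a)); [lra|].
  right. transitivity (s * (exp (a - s * a) * exp (s * a)) + (1 - s) * (exp (- (s * a)) * exp (s * a)));
    [ring|]. rewrite E1, E2. ring.
Qed.

(** Integrating Bernoulli's inequality for (t / y) ^ s against the integrand. *)
Lemma euler_gamma_shift_le (y s : R) : 0 < y -> 0 <= s <= 1 ->
  euler_gamma_integral (y + s) <= Rpower y s * euler_gamma_integral y.
Proof.
  intros Hy Hs.
  assert (HR : is_RInt_gen (fun t => Rpower y s * ((1 - s) * gamma_integrand y t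
                                                + s / y * gamma_integrand (y + 1) t))
                 (at_right 0) (Rbar_locally p_infty)
                 (Rpower y s * ((1 - s) * euler_gamma_integral y
                                + s / y * euler_gamma_integral (y + 1)))).
  { apply (is_RInt_gen_scal (V := R_NormedModule)
             (fun t => (1 - s) * gamma_integrand y t + s / y * gamma_integrand (y + 1) t)).
    apply (is_RInt_gen_plus (V := R_NormedModule)
             (fun t => (1 - s) * gamma_integrand y t)
             (fun t => s / y * gamma_integrand (y + 1) t));
      apply (is_RInt_gen_scal (V := R_NormedModule)), gamma_integral_correct; lra. }
  replace (Rpower y s * euler_gamma_integral y)
    with (Rpower y s * ((1 - s) * euler_gamma_integral y
                        + s / y * euler_gamma_integral (y + 1)))
    by (rewrite euler_gamma_succ by assumption; field; lra).
  eapply Rle_trans; [apply Rle_abs|].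
  assert (HL := gamma_integral_correct (y + s) ltac:(lra)).
  refine (RInt_gen_norm (V := R_CompleteNormedModule) (gamma_integrand (y + s)) _
            (euler_gamma_integral (y + s)) _ _ _ HL HR).
  - now apply filter_prod_half_line.
  - apply filter_prod_half_line. intros a b Ha Hab t Ht; simpl in Ht.
    assert (Ht0 : 0 < t) by lra.
    change (Rabs (gamma_integrand (y + s) t) <= Rpower y s * ((1 - s) * gamma_integrand y t
                                                + s / y * gamma_integrand (y + 1) t)).
    rewrite Rabs_pos_eq by (left; apply gamma_integrand_pos).
    assert (E1 : gamma_integrand (y + s) t = Rpower y s * (Rpower (t / y) s * gamma_integrand y t)).
    { unfold gamma_integrand.
      replace (y + s - 1) with (s + (y - 1)) by ring.
      rewrite Rpower_plus.
      replace (Rpower t s) with (Rpower y s * Rpower (t / y) s); [ring|].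
      rewrite Rpower_mult_distr; [f_equal; field; lra| lra | now apply Rdiv_lt_0_compat]. }
    assert (E2 : gamma_integrand (y + 1) t = t * gamma_integrand y t).
    { unfold gamma_integrand.
      replace (y + 1 - 1) with (1 + (y - 1)) by ring.
      rewrite Rpower_plus, Rpower_1 by assumption. ring. }
    rewrite E1, E2.
    apply Rmult_le_compat_l; [left; apply Rpower_pos|].
    replace ((1 - s) * gamma_integrand y t + s / y * (t * gamma_integrand y t))
      with ((1 - s + s * (t / y)) * gamma_integrand y t) by (field; lra).
    apply Rmult_le_compat_r; [left; apply gamma_integrand_pos|].
    apply Rpower_Bernoulli; [now apply Rdiv_lt_0_compat | assumption].
Qed.

Lemma euler_gamma_pos_nat (s : R) (n : nat) : 0 < s <= 1 ->
  0 < euler_gamma_integral (s + INR n).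
Proof.
  intros Hs. induction n as [|n IH].
  - rewrite Rplus_0_r.
    pose proof (euler_gamma_shift_le s (1 - s) ltac:(lra) ltac:(lra)) as H.
    replace (s + (1 - s)) with 1 in H by ring. rewrite euler_gamma_1 in H.
    pose proof (Rpower_pos s (1 - s)).
    apply (Rmult_lt_reg_l (Rpower s (1 - s))); lra.
  - rewrite S_INR, <- Rplus_assoc, euler_gamma_succ.
    + apply Rmult_lt_0_compat; [pose proof (pos_INR n); lra | exact IH].
    + pose proof (pos_INR n); lra.
Qed.

Definition log_rising (s : R) (n : nat) : R := sum_n (fun k => ln (1 + s / INR (S k))) n.

Lemma log_rising_S (s : R) (n : nat) :
  log_rising s (S n) = log_rising s n + ln (1 + s / INR (S (S n))).
Proof. unfold log_rising. now rewrite sum_Sn. Qed.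

Lemma log_rising_0 (s : R) : log_rising s 0 = ln (1 + s).
Proof. unfold log_rising. rewrite sum_O. simpl INR. f_equal; field. Qed.

(** The recurrence applied n + 2 times to Gamma (s) and n + 1 times to Gamma (1). *)
Lemma ln_euler_gamma_ratio (s : R) (n : nat) : 0 < s < 1 ->
  ln (euler_gamma_integral (s + INR (S (S n)))) - ln (euler_gamma_integral (1 + INR (S n)))
  = ln (euler_gamma_integral s) + ln s + log_rising s n.
Proof.
  intros Hs.
  assert (Hp := fun n => euler_gamma_pos_nat s n ltac:(lra)).
  assert (H1 := fun n => euler_gamma_pos_nat 1 n ltac:(lra)).
  induction n as [|n IH].
  - assert (H0 : 0 < euler_gamma_integral s).
    { specialize (Hp 0%nat). simpl in Hp. now rewrite Rplus_0_r in Hp. }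
    rewrite log_rising_0. simpl INR.
    rewrite (euler_gamma_succ 1), euler_gamma_1 by lra.
    replace (s + (1 + 1)) with (s + 1 + 1) by ring.
    rewrite !euler_gamma_succ, !ln_mult by (lra || (apply Rmult_lt_0_compat; lra)).
    rewrite !ln_1, (Rplus_comm s 1). ring.
  - rewrite log_rising_S, (S_INR (S (S n))), <- Rplus_assoc.
    rewrite (S_INR (S n)), <- (Rplus_assoc 1), <- (S_INR (S n)).
    pose proof (INR_S_pos n). pose proof (INR_S_pos (S n)).
    rewrite !euler_gamma_succ by lra.
    specialize (Hp (S (S n))). specialize (H1 (S n)).
    rewrite !ln_mult by (assumption || lra).
    replace (1 + s / INR (S (S n))) with ((s + INR (S (S n))) / (1 + INR (S n)))
      by (rewrite (S_INR (S n)) in *; field; lra).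
    rewrite ln_div by lra. lra.
Qed.

Lemma ln_1_plus_le (u : R) : -1 < u -> ln (1 + u) <= u.
Proof. intros; pose proof (ln_le_sub_1 (1 + u)); lra. Qed.

(** Gauss's product for the Gamma function: the two bounds of
    [euler_gamma_shift_le] squeeze Gamma (n + s) / Gamma n against n ^ s. *)
Lemma gauss_product (s : R) : 0 < s < 1 ->
  is_lim_seq (fun n => s * ln (INR (S n)) - ln s - log_rising s n) (ln (euler_gamma_integral s)).
Proof.
  intros Hs.
  apply (is_lim_seq_le_le
           (fun n => ln (euler_gamma_integral s) - / INR (S n)) _
           (fun n => ln (euler_gamma_integral s) + / INR (S n))).
  - intros n.
    pose proof (ln_euler_gamma_ratio s n Hs) as E.
    assert (Hp := euler_gamma_pos_nat s (S (S n)) ltac:(lra)).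
    assert (H1 := euler_gamma_pos_nat 1 (S n) ltac:(lra)).
    pose proof (INR_S_pos n) as Hn.
    set (N := INR (S n)) in *.
    assert (HS : INR (S (S n)) = 1 + N) by (rewrite S_INR; unfold N; ring).
    rewrite HS in *.
    assert (U : ln (euler_gamma_integral (s + (1 + N)))
                <= s * ln (1 + N) + ln (euler_gamma_integral (1 + N))).
    { rewrite <- (ln_exp (s * ln (1 + N))).
      change (exp (s * ln (1 + N))) with (Rpower (1 + N) s).
      rewrite <- ln_mult by (apply Rpower_pos || lra).
      apply ln_le; [assumption|].
      rewrite (Rplus_comm s). apply euler_gamma_shift_le; lra. }
    assert (L : ln (1 + N) + ln (euler_gamma_integral (1 + N))
                <= (1 - s) * ln (s + (1 + N)) + ln (euler_gamma_integral (s + (1 + N)))).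
    { rewrite <- (ln_exp ((1 - s) * ln (s + (1 + N)))).
      change (exp ((1 - s) * ln (s + (1 + N)))) with (Rpower (s + (1 + N)) (1 - s)).
      rewrite <- !ln_mult by (apply Rpower_pos || lra).
      apply ln_le; [apply Rmult_lt_0_compat; lra|].
      rewrite <- euler_gamma_succ by lra.
      replace (1 + N + 1) with (s + (1 + N) + (1 - s)) by ring.
      apply euler_gamma_shift_le; lra. }
    assert (B1 : ln (1 + N) - ln N <= / N).
    { rewrite <- ln_div by lra.
      replace ((1 + N) / N) with (1 + / N) by (field; lra).
      apply ln_1_plus_le. assert (0 < / N) by now apply Rinv_0_lt_compat. lra. }
    assert (B2 : ln (s + (1 + N)) - ln (1 + N) <= / N).
    { rewrite <- ln_div by lra.
      replace ((s + (1 + N)) / (1 + N)) with (1 + s / (1 + N)) by (field; lra).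
      eapply Rle_trans; [apply ln_1_plus_le|].
      - assert (0 < s / (1 + N)) by (apply Rdiv_lt_0_compat; lra). lra.
      - apply Rle_trans with (1 / (1 + N)).
        + apply Rmult_le_compat_r; [left; apply Rinv_0_lt_compat|]; lra.
        + unfold Rdiv; rewrite Rmult_1_l. apply Rinv_le_contravar; lra. }
    assert (0 < / N) by now apply Rinv_0_lt_compat.
    assert (B0 : ln N <= ln (1 + N)) by (apply ln_le; lra).
    assert (B4 : ln (1 + N) <= ln (s + (1 + N))) by (apply ln_le; lra).
    assert (s * (ln (1 + N) - ln N) <= 1 * / N) by (apply Rmult_le_compat; lra).
    assert ((1 - s) * (ln (s + (1 + N)) - ln (1 + N)) <= 1 * / N) by (apply Rmult_le_compat; lra).
    assert (0 <= s * (ln (1 + N) - ln N)) by (apply Rmult_le_pos; lra).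
    split; lra.
  - replace (Finite (ln (euler_gamma_integral s))) with (Finite (ln (euler_gamma_integral s) - 0))
      by (f_equal; ring).
    apply is_lim_seq_minus'; [apply is_lim_seq_const|].
    apply (proj1 (is_lim_seq_incr_1 (fun n => / INR n) 0)), is_lim_seq_inv_INR.
  - replace (Finite (ln (euler_gamma_integral s))) with (Finite (ln (euler_gamma_integral s) + 0))
      by (f_equal; ring).
    apply is_lim_seq_plus'; [apply is_lim_seq_const|].
    apply (proj1 (is_lim_seq_incr_1 (fun n => / INR n) 0)), is_lim_seq_inv_INR.
Qed.

Lemma Gamma_pos_arg (t : R) : 0 < t < 1 -> Gamma t = euler_gamma_integral t.
Proof.
  intros Ht. unfold Gamma.
  replace (up (- t)) with 0%Z; [reflexivity|].
  apply tech_up; simpl; lra.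
Qed.

Lemma Gamma_neg_arg (t : R) : -1 < t < 0 -> Gamma t = euler_gamma_integral (1 + t) / t.
Proof.
  intros Ht. unfold Gamma.
  replace (up (- t)) with 1%Z; [simpl; now rewrite Rplus_comm|].
  apply tech_up; simpl; lra.
Qed.

(** Both sides are the logarithm of (1 + t) (2 + t) ... (n + 2 + t) / (n + 1)!. *)
Lemma log_rising_shift (t : R) (n : nat) : -1 < t ->
  ln (1 + t) + log_rising (1 + t) n = log_rising t n + ln (2 + t + INR n).
Proof.
  intros Ht. induction n as [|n IH].
  - rewrite !log_rising_0. simpl INR. replace (1 + (1 + t)) with (2 + t + 0) by ring. ring.
  - rewrite !log_rising_S, (S_INR n).
    pose proof (pos_INR n). pose proof (INR_S_pos (S n)) as HS.
    replace (1 + (1 + t) / INR (S (S n))) with ((2 + t + (INR n + 1)) / INR (S (S n)))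
      by (rewrite !S_INR in *; field; lra).
    replace (1 + t / INR (S (S n))) with ((2 + t + INR n) / INR (S (S n)))
      by (rewrite !S_INR in *; field; lra).
    rewrite !ln_div by lra. lra.
Qed.

(** For t < 0 the product is the one at 1 + t, shifted by one factor. *)
Lemma logGamma_product (t : R) : 0 < Rabs t < 1 ->
  is_lim_seq (fun n => t * ln (INR (S n)) - ln (Rabs t) - log_rising t n) (logGamma t).
Proof.
  intros Ht. unfold logGamma. unfold Rabs in Ht; destruct (Rcase_abs t) as [Hn|Hn].
  - assert (Hs : 0 < 1 + t < 1) by lra.
    assert (HJ : 0 < euler_gamma_integral (1 + t)).
    { pose proof (euler_gamma_pos_nat (1 + t) 0 ltac:(lra)) as H.
      simpl in H. now rewrite Rplus_0_r in H. }
    rewrite Gamma_neg_arg by lra. unfold Rdiv.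
    rewrite Rabs_mult, (Rabs_pos_eq (euler_gamma_integral _)), Rabs_inv by lra.
    assert (Ha : 0 < Rabs t) by (apply Rabs_pos_lt; lra).
    rewrite ln_mult, ln_Rinv by (try assumption; now apply Rinv_0_lt_compat).
    apply (is_lim_seq_ext
      (fun n => ((1 + t) * ln (INR (S n)) - ln (1 + t) - log_rising (1 + t) n)
                + ln (1 + (1 + t) * / INR (S n)) + - ln (Rabs t))).
    { intros n. pose proof (log_rising_shift t n ltac:(lra)) as E.
      pose proof (INR_S_pos n) as HS. pose proof (pos_INR n).
      replace (1 + (1 + t) * / INR (S n)) with ((2 + t + INR n) / INR (S n))
        by (rewrite S_INR in *; field; lra).
      rewrite ln_div by lra. lra. }
    apply is_lim_seq_plus'; [|apply is_lim_seq_const].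
    rewrite <- (Rplus_0_r (ln (euler_gamma_integral _))).
    apply is_lim_seq_plus'; [now apply gauss_product|].
    rewrite <- ln_1. apply (is_lim_seq_continuous ln).
    { apply ex_derive_continuity_pt; auto_derive; lra. }
    replace (Finite 1) with (Finite (1 + (1 + t) * 0)) by (f_equal; ring).
    apply is_lim_seq_plus'; [apply is_lim_seq_const|].
    apply (is_lim_seq_scal_l _ (1 + t) 0).
    apply (proj1 (is_lim_seq_incr_1 (fun n => / INR n) 0)), is_lim_seq_inv_INR.
  - assert (HJ : 0 < euler_gamma_integral t).
    { pose proof (euler_gamma_pos_nat t 0 ltac:(lra)) as H.
      simpl in H. now rewrite Rplus_0_r in H. }
    rewrite Gamma_pos_arg, !Rabs_pos_eq by lra.
    apply gauss_product; lra.
Qed.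

(** * The sine product *)

Definition cos_moment (n : nat) (t : R) : R :=
  RInt (fun x => cos x ^ n * cos (2 * t * x)) 0 (PI / 2).

Lemma cos_moment_continuous (n : nat) (t x : R) :
  continuous (fun x => cos x ^ n * cos (2 * t * x)) x.
Proof.
  apply ex_derive_continuous_R.
  auto_derive; trivial.
Qed.

Lemma cos_moment_ex (n : nat) (t : R) :
  ex_RInt (fun x => cos x ^ n * cos (2 * t * x)) 0 (PI / 2).
Proof. apply (ex_RInt_continuous (V := R_CompleteNormedModule)); intros; apply cos_moment_continuous. Qed.

(** Two integrations by parts. *)
Lemma cos_moment_rec (n : nat) (t : R) :
  (INR (S (S n)) ^ 2 - 4 * t ^ 2) * cos_moment (S (S n)) t
  = INR (S (S n)) * INR (S n) * cos_moment n t.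
Proof.
  set (N := INR (S (S n))).
  assert (HN : INR (S n) = N - 1) by (unfold N; rewrite (S_INR (S n)); ring).
  assert (H : is_RInt (fun x => (N ^ 2 - 4 * t ^ 2) * (cos x ^ S (S n) * cos (2 * t * x))
                                - N * (N - 1) * (cos x ^ n * cos (2 * t * x)))
                0 (PI / 2) 0).
  { (* The boundary terms of both integrations by parts, collected in G, vanish
       at 0 and at pi / 2. *)
    set (G := fun x => cos x ^ (S n) * (N * sin x * cos (2 * t * x)
                                        - 2 * t * cos x * sin (2 * t * x))).
    replace 0 with (minus (G (PI / 2)) (G 0)) at 2.
    2:{ unfold G, minus, plus, opp; simpl. rewrite cos_PI2, sin_0, Rmult_0_r, sin_0. ring. }
    apply (is_RInt_derive (V := R_CompleteNormedModule) G).
    - intros x _. unfold G. auto_derive; trivial.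
      change (match n with O => 1 | S _ => INR n + 1 end) with (INR (S n)). rewrite HN.
      pose proof (sin2_cos2 x) as Hs. unfold Rsqr in Hs.
      assert (Hs2 : sin x * sin x = 1 - cos x * cos x) by lra.
      simpl pow.
      transitivity (- (N * (N - 1)) * (sin x * sin x) * cos x ^ n * cos (2 * t * x)
                    + (N - 4 * t ^ 2) * cos x * cos x * cos x ^ n * cos (2 * t * x));
        [simpl; ring | rewrite Hs2; simpl; ring].
    - intros x _. apply ex_derive_continuous_R.
      auto_derive; trivial. }
  apply (is_RInt_unique (V := R_CompleteNormedModule)) in H.
  rewrite (RInt_minus (V := R_CompleteNormedModule)
            (fun x => (N ^ 2 - 4 * t ^ 2) * (cos x ^ S (S n) * cos (2 * t * x)))
            (fun x => N * (N - 1) * (cos x ^ n * cos (2 * t * x)))) in H.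
  2,3: apply (ex_RInt_scal (V := R_NormedModule)), cos_moment_ex.
  rewrite (RInt_scal (V := R_CompleteNormedModule) (fun x => cos x ^ S (S n) * cos (2 * t * x)))
    in H by apply cos_moment_ex.
  rewrite (RInt_scal (V := R_CompleteNormedModule) (fun x => cos x ^ n * cos (2 * t * x)))
    in H by apply cos_moment_ex.
  unfold minus, plus, opp, scal in H; simpl in H; unfold mult in H; simpl in H.
  rewrite HN. unfold cos_moment. simpl. lra.
Qed.

Lemma cos_moment_0 (t : R) : 2 * t * cos_moment 0 t = sin (PI * t).
Proof.
  assert (H : is_RInt (fun x => 2 * t * (cos x ^ 0 * cos (2 * t * x))) 0 (PI / 2)
                (minus (sin (2 * t * (PI / 2))) (sin (2 * t * 0)))).
  { apply (is_RInt_derive (V := R_CompleteNormedModule) (fun x => sin (2 * t * x))).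
    - intros x _. auto_derive; trivial. simpl; ring.
    - intros x _. apply ex_derive_continuous_R.
      auto_derive; trivial. }
  apply (is_RInt_unique (V := R_CompleteNormedModule)) in H.
  rewrite (RInt_scal (V := R_CompleteNormedModule) (fun x => cos x ^ 0 * cos (2 * t * x)))
    in H by apply cos_moment_ex.
  unfold minus, plus, opp, scal in H; simpl in H; unfold mult in H; simpl in H.
  unfold cos_moment; simpl. rewrite H, Rmult_0_r, sin_0.
  replace (2 * t * (PI / 2)) with (PI * t) by field. ring.
Qed.

Lemma cos_moment_0_0 : cos_moment 0 0 = PI / 2.
Proof.
  unfold cos_moment.
  rewrite (RInt_ext _ (fun _ => 1)).
  - rewrite RInt_const. unfold scal; simpl; unfold mult; simpl; ring.
  - intros x _. replace (2 * 0 * x) with 0 by ring. rewrite cos_0. simpl; ring.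
Qed.

Lemma x_cos_le_sin (x : R) : 0 <= x -> x <= PI / 2 -> x * cos x <= sin x.
Proof.
  intros H0 H1. pose proof PI_RGT_0.
  destruct (MVT_gen (fun x => sin x - x * cos x) 0 x (fun x => x * sin x))
    as [c [Hc E]].
  - intros y _. auto_derive; trivial. ring.
  - intros y _. apply ex_derive_continuity_pt. auto_derive; trivial.
  - rewrite Rmin_left, Rmax_right in Hc by lra.
    rewrite sin_0 in E.
    assert (0 <= sin c) by (apply sin_ge_0; lra).
    assert (0 <= c * sin c * (x - 0)) by (repeat apply Rmult_le_pos; lra).
    lra.
Qed.

Lemma one_minus_cos_le (u : R) : 0 <= 1 - cos u <= u ^ 2 / 2.
Proof.
  split; [pose proof (COS_bound u); lra|].
  replace u with (2 * (u / 2)) at 1 by field.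
  rewrite cos_2a_sin.
  assert (H : (sin (u / 2)) ^ 2 <= (u / 2) ^ 2).
  { rewrite <- !Rsqr_pow2. apply Rsqr_le_abs_1.
    destruct (Rle_or_lt 0 (u / 2)) as [H|H].
    - destruct H as [H|H]; [|rewrite <- H, sin_0; lra].
      rewrite (Rabs_pos_eq (u / 2)) by lra.
      apply Rabs_le; split; [|left; now apply sin_lt_x].
      destruct (Rle_or_lt (u / 2) PI) as [H'|H'].
      + assert (0 <= sin (u / 2)) by (apply sin_ge_0; lra). lra.
      + pose proof (SIN_bound (u / 2)). pose proof PI2_1. lra.
    - rewrite <- (Rabs_Ropp (sin _)), <- sin_neg, <- (Rabs_Ropp (u / 2)).
      rewrite (Rabs_pos_eq (- (u / 2))) by lra.
      apply Rabs_le; split; [|left; apply sin_lt_x; lra].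
      destruct (Rle_or_lt (- (u / 2)) PI) as [H'|H'].
      + assert (0 <= sin (- (u / 2))) by (apply sin_ge_0; lra). lra.
      + pose proof (SIN_bound (- (u / 2))). pose proof PI2_1. lra. }
  simpl in H |- *. nra.
Qed.

Definition even_moment (n : nat) (t : R) : R := cos_moment (2 * n) t.

(** The ratio of the moments at t and at 0 therefore loses the factor
    1 - t^2 / (n+1)^2 when n increases by one: this is how the product arises. *)
Lemma even_moment_rec (n : nat) (t : R) :
  (1 - (t / INR (S n)) ^ 2) * even_moment (S n) t
  = (2 * INR n + 1) / (2 * INR n + 2) * even_moment n t.
Proof.
  unfold even_moment. pose proof (cos_moment_rec (2 * n) t) as H.
  replace (2 * S n)%nat with (S (S (2 * n))) by lia.
  pose proof (pos_INR n).
  rewrite !S_INR, mult_INR in H. rewrite S_INR. simpl (INR 2) in H.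
  apply (Rmult_eq_reg_l ((2 * INR n + 2) ^ 2)); [|nra].
  transitivity ((((1 + 1) * INR n + 1 + 1) ^ 2 - 4 * t ^ 2) * cos_moment (S (S (2 * n))) t).
  - field. lra.
  - rewrite H. field. lra.
Qed.

Lemma even_moment_pos (n : nat) : 0 < even_moment n 0.
Proof.
  pose proof PI_RGT_0.
  unfold even_moment, cos_moment. apply RInt_gt_0; [lra | |intros; apply cos_moment_continuous].
  intros x Hx. replace (2 * 0 * x) with 0 by ring. rewrite cos_0, Rmult_1_r.
  apply pow_lt, cos_gt_0; lra.
Qed.

(** As n grows the mass of cos ^ (2n) concentrates at 0, where cos (2 t x) is 1.
    The estimate uses 1 - cos (2 t x) <= 2 t^2 x^2, then x cos x <= sin x to bound
    x^2 cos ^ (2n+2) by cos ^ (2n) - cos ^ (2n+2), whose integral the recurrence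
    gives. *)
Lemma even_moment_close (n : nat) (t : R) :
  0 <= 1 - even_moment (S n) t / even_moment (S n) 0 <= 2 * t ^ 2 / (2 * INR n + 1).
Proof.
  pose proof PI_RGT_0 as Hpi. pose proof (pos_INR n) as Hn.
  pose proof (even_moment_pos (S n)) as HW.
  assert (Hr : even_moment n 0 - even_moment (S n) 0 = even_moment (S n) 0 / (2 * INR n + 1)).
  { pose proof (even_moment_rec n 0) as H. unfold Rdiv at 1 in H.
    rewrite Rmult_0_l, pow_ne_zero, Rminus_0_r, Rmult_1_l in H by lia.
    rewrite H. field. lra. }
  assert (Hb : 0 <= even_moment (S n) 0 - even_moment (S n) t
               <= 2 * t ^ 2 * (even_moment n 0 - even_moment (S n) 0)).
  { unfold even_moment, cos_moment.
    assert (Em := fun k t => cos_moment_ex k t).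
    assert (Es : forall k l s t, ex_RInt (fun x => minus (cos x ^ k * cos (2 * s * x))
                                               (cos x ^ l * cos (2 * t * x))) 0 (PI / 2)).
    { intros. apply (ex_RInt_minus (V := R_NormedModule)); apply Em. }
    change Rminus with (@minus R_AbelianGroup).
    rewrite <- !(RInt_minus (V := R_CompleteNormedModule)) by apply Em.
    change (2 * t ^ 2 * ?a) with (scal (2 * t ^ 2) a).
    rewrite <- (RInt_scal (V := R_CompleteNormedModule)) by apply Es.
    assert (K : forall x, 0 < x < PI / 2 ->
      0 <= cos x ^ (2 * S n) * cos (2 * 0 * x) - cos x ^ (2 * S n) * cos (2 * t * x) <=
      2 * t ^ 2 * (cos x ^ (2 * n) * cos (2 * 0 * x) - cos x ^ (2 * S n) * cos (2 * 0 * x))).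
    { intros x Hx. replace (2 * 0 * x) with 0 by ring. rewrite cos_0.
      pose proof (one_minus_cos_le (2 * t * x)) as Hc.
      assert (Hcx : 0 < cos x) by (apply cos_gt_0; lra).
      pose proof (pow_lt _ (2 * n) Hcx) as Hp.
      replace (2 * S n)%nat with (S (S (2 * n))) by lia.
      set (q := cos x ^ (2 * n)) in *.
      assert (Hx2 : (x * cos x) ^ 2 <= 1 - cos x * cos x).
      { pose proof (sin2_cos2 x) as Hs. unfold Rsqr in Hs.
        replace (1 - cos x * cos x) with (sin x ^ 2) by (simpl; lra).
        apply pow_incr. split; [apply Rmult_le_pos; lra | apply x_cos_le_sin; lra]. }
      change (cos x ^ S (S (2 * n))) with (cos x * (cos x * q)).
      split.
      - replace (_ - _) with (q * (cos x * cos x) * (1 - cos (2 * t * x))) by ring.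
        apply Rmult_le_pos; [|lra]. apply Rmult_le_pos; nra.
      - apply Rle_trans with (q * (cos x * cos x) * ((2 * t * x) ^ 2 / 2)).
        + replace (_ - _) with (q * (cos x * cos x) * (1 - cos (2 * t * x))) by ring.
          apply Rmult_le_compat_l; [|lra]. apply Rmult_le_pos; nra.
        + replace (q * (cos x * cos x) * ((2 * t * x) ^ 2 / 2))
            with (2 * t ^ 2 * q * (x * cos x) ^ 2) by field.
          replace (2 * t ^ 2 * (q * 1 - cos x * (cos x * q) * 1))
            with (2 * t ^ 2 * q * (1 - cos x * cos x)) by ring.
          apply Rmult_le_compat_l; [|assumption].
          pose proof (pow2_ge_0 t). nra. }
    split.
    - apply RInt_ge_0; [lra | apply Es | intros x Hx; apply (K x Hx)].
    - apply RInt_le; [lra | apply Es | | intros x Hx; apply (K x Hx)].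
      apply (ex_RInt_scal (V := R_NormedModule)), Es. }
  rewrite Hr in Hb.
  set (w := even_moment (S n) 0) in *. set (v := even_moment (S n) t) in *.
  replace (1 - v / w) with ((w - v) / w) by (field; lra).
  split.
  - apply Rmult_le_pos; [lra | left; now apply Rinv_0_lt_compat].
  - apply (Rmult_le_reg_r w); [assumption|].
    replace ((w - v) / w * w) with (w - v) by (field; lra).
    eapply Rle_trans; [apply (proj2 Hb)|]. right; field; lra.
Qed.

Lemma ratio_lt_1 (t : R) (k : nat) : Rabs t < 1 -> Rabs (t / INR (S k)) < 1.
Proof.
  intros Ht. pose proof (INR_S_pos k).
  assert (1 <= INR (S k)) by (rewrite S_INR; pose proof (pos_INR k); lra).
  unfold Rdiv. rewrite Rabs_mult, (Rabs_pos_eq (/ _)) by (left; now apply Rinv_0_lt_compat).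
  apply (Rmult_lt_reg_r (INR (S k))); [assumption|].
  rewrite Rmult_assoc, Rinv_l by lra. lra.
Qed.

Lemma one_minus_sq_pos (x : R) : Rabs x < 1 -> 0 < 1 - x ^ 2.
Proof. intros H. apply Rabs_def2 in H. simpl. nra. Qed.

Lemma sin_PI_ratio_pos (t : R) : 0 < Rabs t < 1 -> 0 < sin (PI * t) / (PI * t).
Proof.
  intros H. pose proof PI_RGT_0 as Hpi.
  unfold Rabs in H; destruct (Rcase_abs t) as [Ht|Ht].
  - replace (PI * t) with (- (PI * - t)) by ring.
    rewrite sin_neg.
    assert (0 < sin (PI * - t)) by (apply sin_gt_0; nra).
    replace (- sin (PI * - t) / - (PI * - t)) with (sin (PI * - t) / (PI * - t))
      by (field; split; lra).
    apply Rdiv_lt_0_compat; nra.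
  - apply Rdiv_lt_0_compat; [apply sin_gt_0|]; nra.
Qed.

(** Euler's product for the sine, in logarithmic form. *)
Lemma ln_sine_product (t : R) : 0 < Rabs t < 1 ->
  is_lim_seq (sum_n (fun k => ln (1 - (t / INR (S k)) ^ 2))) (ln (sin (PI * t) / (PI * t))).
Proof.
  intros Ht. pose proof PI_RGT_0 as Hpi.
  assert (Ht0 : t <> 0) by (intros ->; rewrite Rabs_R0 in Ht; lra).
  set (q := fun n => even_moment n t / even_moment n 0).
  assert (Hq : forall n, q n = (1 - (t / INR (S n)) ^ 2) * q (S n)).
  { intros n. unfold q. pose proof (even_moment_rec n t) as H1.
    pose proof (even_moment_rec n 0) as H0. unfold Rdiv in H0 at 1.
    rewrite Rmult_0_l, pow_ne_zero, Rminus_0_r, Rmult_1_l in H0 by lia.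
    pose proof (even_moment_pos n). pose proof (pos_INR n).
    rewrite H0.
    transitivity ((1 - (t / INR (S n)) ^ 2) * even_moment (S n) t /
       ((2 * INR n + 1) / (2 * INR n + 2) * even_moment n 0)).
    - rewrite H1. field. lra.
    - field. repeat split; try lra. apply not_0_INR; lia. }
  assert (Hq0 : q 0%nat = sin (PI * t) / (PI * t)).
  { unfold q, even_moment. rewrite Nat.mul_0_r, cos_moment_0_0, <- cos_moment_0. field. lra. }
  assert (Hpos : forall n, 0 < q n).
  { induction n as [|n IH]; [rewrite Hq0; now apply sin_PI_ratio_pos|].
    rewrite Hq in IH.
    apply (Rmult_lt_reg_l (1 - (t / INR (S n)) ^ 2)); [|lra].
    now apply one_minus_sq_pos, ratio_lt_1. }
  assert (Hs : forall n, (sum_n (fun k => ln (1 - (t / INR (S k)) ^ 2)) n : R)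
                         = ln (sin (PI * t) / (PI * t)) - ln (q (S n))).
  { rewrite <- Hq0. induction n as [|n IH].
    - rewrite sum_O, (Hq 0%nat).
      rewrite ln_mult by (apply Hpos || now apply one_minus_sq_pos, ratio_lt_1).
      ring.
    - rewrite sum_Sn, IH, (Hq (S n)).
      rewrite ln_mult by (apply Hpos || now apply one_minus_sq_pos, ratio_lt_1).
      unfold plus; simpl. ring. }
  apply (is_lim_seq_ext (fun n => ln (sin (PI * t) / (PI * t)) - ln (q (S n)))); [now intros|].
  replace (Finite (ln (sin (PI * t) / (PI * t))))
    with (Finite (ln (sin (PI * t) / (PI * t)) - ln 1)) by (f_equal; rewrite ln_1; ring).
  apply is_lim_seq_minus'; [apply is_lim_seq_const|].
  apply (is_lim_seq_continuous ln); [apply ex_derive_continuity_pt; auto_derive; lra|].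
  apply (is_lim_seq_le_le (fun n => 1 - 2 * t ^ 2 * / INR (S n)) _ (fun _ => 1)).
  - intros n. pose proof (even_moment_close n t) as H. fold (q (S n)) in H.
    split; [|lra].
    assert (2 * t ^ 2 / (2 * INR n + 1) <= 2 * t ^ 2 * / INR (S n)); [|lra].
    apply Rmult_le_compat_l; [pose proof (pow2_ge_0 t); lra|].
    rewrite S_INR. pose proof (pos_INR n). apply Rinv_le_contravar; lra.
  - replace (Finite 1) with (Finite (1 - 2 * t ^ 2 * 0)) by (f_equal; ring).
    apply is_lim_seq_minus'; [apply is_lim_seq_const|].
    apply (is_lim_seq_scal_l _ (2 * t ^ 2) 0).
    apply (proj1 (is_lim_seq_incr_1 (fun n => / INR n) 0)), is_lim_seq_inv_INR.
  - apply is_lim_seq_const.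
Qed.

(** * The Fourier series of - log (2 sin (x / 2)) *)

Definition harmonic (n : nat) : R := sum_n_m (fun k => / INR k) 1 n.

Lemma harmonic_S (n : nat) : harmonic (S n) = harmonic n + / INR (S n).
Proof. unfold harmonic. now rewrite sum_n_Sm by lia. Qed.

Lemma harmonic_0 : harmonic 0 = 0.
Proof. unfold harmonic. now rewrite sum_n_m_zero by lia. Qed.

Lemma ln_succ_bounds (n : nat) :
  / INR (S (S n)) <= ln (INR (S (S n))) - ln (INR (S n)) <= / INR (S n).
Proof.
  pose proof (INR_S_pos n) as H. rewrite (S_INR (S n)). set (N := INR (S n)) in *.
  assert (0 < / N) by now apply Rinv_0_lt_compat.
  assert (/ (N + 1) < 1) by (rewrite <- Rinv_1; apply Rinv_lt_contravar; lra).
  split.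
  - assert (Hl : ln (N / (N + 1)) <= N / (N + 1) - 1)
      by (apply ln_le_sub_1, Rdiv_lt_0_compat; lra).
    rewrite ln_div in Hl by lra.
    replace (N / (N + 1) - 1) with (- / (N + 1)) in Hl by (field; lra). lra.
  - rewrite <- ln_div by lra. replace ((N + 1) / N) with (1 + / N) by (field; lra).
    apply ln_1_plus_le. lra.
Qed.

Lemma euler_mascheroni_lim :
  is_lim_seq (fun n => harmonic (S n) - ln (INR (S n))) euler_mascheroni.
Proof.
  assert (H : ex_finite_lim_seq (fun n => harmonic (S n) - ln (INR (S n)))).
  { apply ex_finite_lim_seq_decr with 0.
    - intros n. rewrite (harmonic_S (S n)). pose proof (ln_succ_bounds n). lra.
    - intros n. assert (Hn : ln (INR (S (S n))) <= harmonic (S n)).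
      { induction n as [|n IH].
        - rewrite harmonic_S, harmonic_0. pose proof (ln_succ_bounds 0) as H0.
          simpl INR in *. rewrite ln_1 in H0. lra.
        - rewrite (harmonic_S (S n)). pose proof (ln_succ_bounds (S n)). lra. }
      pose proof (ln_succ_bounds n). pose proof (INR_S_pos (S n)).
      assert (0 < / INR (S (S n))) by now apply Rinv_0_lt_compat. lra. }
  unfold euler_mascheroni.
  change (fun n => sum_n_m (fun k => / INR k) 1 n - ln (INR n))
    with (fun n => harmonic n - ln (INR n)).
  rewrite <- (Lim_seq_incr_1 (fun n => harmonic n - ln (INR n))).
  apply Lim_seq_correct', H.
Qed.

(** Multiplying by 2 sin (x / 2) makes the sum telescope. *)
Lemma sum_sin (n : nat) (x : R) :
  2 * sin (x / 2) * sum_n (fun k => sin (INR (S k) * x)) n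
  = cos (x / 2) - cos ((INR n + 3 / 2) * x).
Proof.
  assert (P : forall b, 2 * sin (x / 2) * sin b = cos (b - x / 2) - cos (b + x / 2)).
  { intros b. rewrite cos_minus, cos_plus. ring. }
  induction n as [|n IH].
  - rewrite sum_O, P. simpl INR.
    replace (1 * x - x / 2) with (x / 2) by field.
    now replace (1 * x + x / 2) with ((0 + 3 / 2) * x) by field.
  - rewrite sum_Sn. change plus with Rplus. rewrite Rmult_plus_distr_l, IH, P.
    rewrite !S_INR.
    replace ((INR n + 1 + 1) * x - x / 2) with ((INR n + 3 / 2) * x) by field.
    replace ((INR n + 1 + 1) * x + x / 2) with ((INR n + 1 + 3 / 2) * x) by field. ring.
Qed.

Definition cos_sum (n : nat) (x : R) : R := sum_n (fun k => cos (INR (S k) * x) / INR (S k)) n.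

Lemma is_derive_cos_sum (n : nat) (x : R) :
  is_derive (cos_sum n) x (- sum_n (fun k => sin (INR (S k) * x)) n).
Proof.
  replace (- sum_n (fun k => sin (INR (S k) * x)) n)
    with (sum_n (fun k => - sin (INR (S k) * x)) n).
  - apply (is_derive_sum_n (fun k x => cos (INR (S k) * x) / INR (S k))).
    intros k _. pose proof (INR_S_pos k). generalize dependent (INR (S k)). intros y Hy.
    auto_derive; [trivial|]. field. lra.
  - induction n as [|n IH]; [now rewrite !sum_O|].
    rewrite !sum_Sn, IH. unfold plus; simpl. ring.
Qed.

(** Subtracting the oscillating term sin (a x) / (2 a sin (x / 2)), a = n + 3/2,
    leaves a function whose derivative is O(1 / n). *)
Definition cos_sum_error (n : nat) (x : R) : R :=
  cos_sum n x + ln (2 * sin (x / 2))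
  - sin ((INR n + 3 / 2) * x) / (2 * (INR n + 3 / 2) * sin (x / 2)).

Lemma is_derive_cos_sum_error (n : nat) (x : R) : 0 < sin (x / 2) ->
  is_derive (cos_sum_error n) x
    (sin ((INR n + 3 / 2) * x) * cos (x / 2) / (4 * (INR n + 3 / 2) * sin (x / 2) ^ 2)).
Proof.
  intros Hs. pose proof (pos_INR n) as Hn. pose proof (sum_sin n x) as E.
  set (a := INR n + 3 / 2) in *.
  assert (E' : - sum_n (fun k => sin (INR (S k) * x)) n
               = - (cos (x / 2) - cos (a * x)) / (2 * sin (x / 2))).
  { rewrite <- E. field. lra. }
  replace (sin (a * x) * cos (x / 2) / (4 * a * sin (x / 2) ^ 2))
    with (minus (plus (- sum_n (fun k => sin (INR (S k) * x)) n) (cos (x / 2) / (2 * sin (x / 2))))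
            (cos (a * x) / (2 * sin (x / 2))
             - sin (a * x) * cos (x / 2) / (4 * a * sin (x / 2) ^ 2))).
  2:{ rewrite E'. unfold minus, plus, opp; simpl. field. unfold a; split; lra. }
  apply (is_derive_minus (K := R_AbsRing) (V := R_NormedModule)
      (fun x => cos_sum n x + ln (2 * sin (x / 2)))
      (fun x => sin (a * x) / (2 * a * sin (x / 2)))).
  - apply (is_derive_plus (K := R_AbsRing) (V := R_NormedModule)
               (cos_sum n) (fun x => ln (2 * sin (x / 2)))).
    + apply is_derive_cos_sum.
    + auto_derive; [lra|]. change (x * / 2) with (x / 2). field. lra.
  - auto_derive; [change (x * / 2) with (x / 2); unfold a; apply Rgt_not_eq; nra|].
    change (x * / 2) with (x / 2). field. unfold a; split; lra.
Qed.

(** At pi the signs alternate, and twice the sum over the even indices is a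
    harmonic sum again. *)
Lemma cos_sum_PI (j : nat) :
  cos_sum (2 * j + 1) PI = harmonic (S j) - harmonic (2 * j + 2).
Proof.
  assert (Hodd : forall k, cos (INR (2 * k + 1) * PI) = -1).
  { intros k. rewrite plus_INR, mult_INR. simpl (INR 2). simpl (INR 1).
    replace (((1 + 1) * INR k + 1) * PI) with (PI + 2 * INR k * PI) by ring.
    rewrite cos_period. apply cos_PI. }
  assert (Hev : forall k, cos (INR (2 * k + 2) * PI) = 1).
  { intros k. rewrite plus_INR, mult_INR. simpl (INR 2).
    replace (((1 + 1) * INR k + (1 + 1)) * PI) with (PI + PI + 2 * INR k * PI) by ring.
    rewrite cos_period, neg_cos, cos_PI. ring. }
  unfold cos_sum. induction j as [|j IH].
  - change (2 * 0 + 1)%nat with 1%nat. rewrite sum_Sn, sum_O. change plus with Rplus.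
    pose proof (Hodd 0%nat) as E1. pose proof (Hev 0%nat) as E2.
    cbn [Nat.mul Nat.add] in *. rewrite E1, E2, !harmonic_S, harmonic_0. simpl INR. field.
  - replace (2 * S j + 1)%nat with (S (S (2 * j + 1))) by lia.
    rewrite !sum_Sn, IH. change plus with Rplus.
    pose proof (Hodd (S j)) as E1. pose proof (Hev (S j)) as E2.
    replace (2 * S j + 1)%nat with (S (S (2 * j + 1))) in E1 by lia.
    replace (2 * S j + 2)%nat with (S (S (S (2 * j + 1)))) in E2 by lia.
    rewrite E1, E2.
    replace (2 * S j + 2)%nat with (S (S (2 * j + 2))) by lia.
    rewrite (harmonic_S (S j)), (harmonic_S (S (2 * j + 2))), (harmonic_S (2 * j + 2)).
    replace (S (S (2 * j + 1))) with (S (2 * j + 2)) by lia.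
    assert (E : INR (S (S (2 * j + 2))) = 2 * INR (S (S j))).
    { replace (S (S (2 * j + 2))) with (2 * S (S j))%nat by lia. now rewrite mult_INR. }
    rewrite E. pose proof (INR_S_pos (S j)). pose proof (INR_S_pos (2 * j + 2)). field. lra.
Qed.

(** The Euler constants of the two harmonic sums cancel. *)
Lemma cos_sum_PI_lim : is_lim_seq (fun j => cos_sum (2 * j + 1) PI) (- ln 2).
Proof.
  apply (is_lim_seq_ext (fun j =>
    (harmonic (S j) - ln (INR (S j)))
    - (harmonic (S (2 * j + 1)) - ln (INR (S (2 * j + 1)))) + - ln 2)).
  - intros j. rewrite cos_sum_PI.
    replace (S (2 * j + 1)) with (2 * S j)%nat by lia.
    replace (2 * j + 2)%nat with (2 * S j)%nat by lia.
    rewrite (mult_INR 2 (S j)), ln_mult by (apply INR_S_pos || (simpl; lra)).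
    change (INR 2) with (1 + 1). replace (1 + 1) with 2 by ring. lra.
  - replace (Finite (- ln 2)) with (Finite (euler_mascheroni - euler_mascheroni + - ln 2))
      by (f_equal; ring).
    apply is_lim_seq_plus'; [|apply is_lim_seq_const].
    apply is_lim_seq_minus'; [apply euler_mascheroni_lim|].
    apply (is_lim_seq_subseq (fun n => harmonic (S n) - ln (INR (S n))) _ (fun j => (2 * j + 1)%nat)).
    + apply eventually_subseq. intros n; lia.
    + apply euler_mascheroni_lim.
Qed.

Lemma sin_half_ge (d x : R) : 0 < d < PI -> Rabs (x - PI) < PI - d ->
  sin (d / 2) <= sin (x / 2).
Proof.
  intros Hd Hx. apply Rabs_def2 in Hx.
  assert (H1 : d / 2 <= PI / 2) by lra.
  destruct (Rle_or_lt x PI) as [H|H].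
  - apply sin_incr_1; lra.
  - rewrite <- (sin_PI_x (x / 2)). apply sin_incr_1; lra.
Qed.

(** Locally uniform convergence of the sums of cos (k x) / k to - log (2 sin (x / 2)):
    by the mean value theorem the error at x differs by O(1 / n) from the error at
    pi, where the limit is known.  The interval stays at distance d from the
    endpoints 0 and 2 pi, where the sine vanishes. *)
Lemma cos_sum_bound (d : R) : 0 < d < PI ->
  exists K, 0 <= K /\ forall n x, Rabs (x - PI) < PI - d ->
    Rabs (cos_sum n x + ln (2 * sin (x / 2)))
    <= K * / INR (S n) + Rabs (cos_sum n PI + ln 2).
Proof.
  intros Hd. pose proof PI_RGT_0 as Hpi.
  set (s := sin (d / 2)).
  assert (Hs : 0 < s) by (apply sin_gt_0; lra).
  assert (Hs1 : s <= 1) by apply SIN_bound.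
  set (K := / (2 * s) + PI / (4 * s ^ 2) + 1).
  assert (Hs2 : 0 < s ^ 2) by (apply pow_lt, Hs).
  exists K. split.
  { unfold K. assert (0 < / (2 * s)) by (apply Rinv_0_lt_compat; lra).
    assert (0 < PI / (4 * s ^ 2)) by (apply Rdiv_lt_0_compat; lra). lra. }
  intros n x Hx. pose proof (pos_INR n) as Hn.
  set (a := INR n + 3 / 2).
  assert (Ha : 0 < a) by (unfold a; lra).
  assert (Hav : / a <= / INR (S n)) by (rewrite S_INR; apply Rinv_le_contravar; unfold a; lra).
  assert (Hia : 0 < / a) by now apply Rinv_0_lt_compat.
  assert (Hsx : s <= sin (x / 2)) by (now apply sin_half_ge).
  assert (Hosc : forall y, s <= sin (y / 2) ->
            Rabs (sin (a * y) / (2 * a * sin (y / 2))) <= / (2 * s) * / a).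
  { intros y Hy. unfold Rdiv. rewrite Rabs_mult, Rabs_inv.
    rewrite (Rabs_pos_eq (2 * a * _)) by (apply Rmult_le_pos; lra).
    replace (/ (2 * s) * / a) with (1 * / (2 * a * s)) by (field; lra).
    apply Rmult_le_compat.
    - apply Rabs_pos.
    - left. apply Rinv_0_lt_compat. nra.
    - apply Rabs_le. pose proof (SIN_bound (a * y)). lra.
    - apply Rinv_le_contravar; nra. }
  destruct (MVT_gen (cos_sum_error n) PI x
              (fun x => sin (a * x) * cos (x / 2) / (4 * a * sin (x / 2) ^ 2))) as (c & Hc & E).
  { intros y Hy. apply is_derive_cos_sum_error.
    apply Rlt_le_trans with s; [assumption|].
    apply sin_half_ge; [assumption|]. apply Rabs_def2 in Hx.
    unfold Rmin, Rmax in Hy. destruct (Rle_dec PI x); apply Rabs_def1; lra. }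
  { intros y Hy. apply ex_derive_continuity_pt. eexists. apply is_derive_cos_sum_error.
    apply Rlt_le_trans with s; [assumption|].
    apply sin_half_ge; [assumption|]. apply Rabs_def2 in Hx.
    unfold Rmin, Rmax in Hy. destruct (Rle_dec PI x); apply Rabs_def1; lra. }
  assert (Hsc : s <= sin (c / 2)).
  { apply sin_half_ge; [assumption|]. apply Rabs_def2 in Hx.
    unfold Rmin, Rmax in Hc. destruct (Rle_dec PI x); apply Rabs_def1; lra. }
  assert (HE : Rabs (cos_sum_error n x - cos_sum_error n PI) <= PI / (4 * s ^ 2) * / a).
  { rewrite E, Rabs_mult.
    replace (PI / (4 * s ^ 2) * / a) with (/ (4 * a * s ^ 2) * PI) by (field; lra).
    apply Rmult_le_compat; [apply Rabs_pos | apply Rabs_pos | | lra].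
    unfold Rdiv. rewrite Rabs_mult, Rabs_inv.
    assert (s ^ 2 <= sin (c / 2) ^ 2) by (apply pow_incr; lra).
    assert (0 < a * s ^ 2) by (apply Rmult_lt_0_compat; lra).
    rewrite (Rabs_pos_eq (4 * a * _)) by nra.
    rewrite <- (Rmult_1_l (/ (4 * a * s ^ 2))).
    apply Rmult_le_compat.
    - apply Rabs_pos.
    - left. apply Rinv_0_lt_compat. nra.
    - rewrite Rabs_mult, <- (Rmult_1_l 1). apply Rmult_le_compat; try apply Rabs_pos;
        apply Rabs_le; apply SIN_bound || apply COS_bound.
    - apply Rinv_le_contravar; nra. }
  pose proof (Hosc x Hsx) as O1.
  assert (HsP : sin (PI / 2) = 1) by apply sin_PI2.
  assert (O2 : Rabs (sin (a * PI) / (2 * a * sin (PI / 2))) <= 1 * / a).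
  { rewrite HsP. unfold Rdiv. rewrite Rabs_mult, Rabs_inv, (Rabs_pos_eq (2 * a * 1)), Rmult_1_r by lra.
    replace (1 * / a) with (2 * / (2 * a)) by (field; lra).
    apply Rmult_le_compat_r; [left; apply Rinv_0_lt_compat; lra|].
    apply Rabs_le. pose proof (SIN_bound (a * PI)). lra. }
  unfold cos_sum_error in HE. fold a in HE. rewrite HsP in HE at 1. rewrite Rmult_1_r in HE.
  apply Rle_trans with (K * / a + Rabs (cos_sum n PI + ln 2)).
  - replace (cos_sum n x + ln (2 * sin (x / 2)))
      with ((cos_sum n x + ln (2 * sin (x / 2)) - sin (a * x) / (2 * a * sin (x / 2))
             - (cos_sum n PI + ln 2 - sin (a * PI) / (2 * a * sin (PI / 2))))
            + sin (a * x) / (2 * a * sin (x / 2))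
            + (cos_sum n PI + ln 2)
            + - (sin (a * PI) / (2 * a * sin (PI / 2)))) by ring.
    assert (T : forall u v w y, Rabs (u + v + w + - y) <= Rabs u + Rabs v + Rabs w + Rabs y).
    { intros. rewrite <- (Rabs_Ropp y).
      pose proof (Rabs_triang (u + v + w) (- y)). pose proof (Rabs_triang (u + v) w).
      pose proof (Rabs_triang u v). lra. }
    eapply Rle_trans; [apply T|]. unfold K.
    rewrite !Rmult_plus_distr_r. lra.
  - apply Rplus_le_compat_r, Rmult_le_compat_l; [|assumption].
    unfold K. assert (0 < / (2 * s)) by (apply Rinv_0_lt_compat; lra).
    assert (0 < PI / (4 * s ^ 2)) by (apply Rdiv_lt_0_compat; lra). lra.
Qed.

(** * Clausen functions *)

Definition clausen_term (n k : nat) (x : R) : R :=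
  (if Nat.even n then sin (INR (S k) * x) else cos (INR (S k) * x)) / INR (S k) ^ n.

Lemma clausen_term_bound (n k : nat) (x : R) : Rabs (clausen_term n k x) <= / INR (S k) ^ n.
Proof.
  unfold clausen_term, Rdiv. rewrite Rabs_mult, Rabs_inv.
  pose proof (pow_lt _ n (INR_S_pos k)) as Hp.
  rewrite (Rabs_pos_eq (_ ^ n)) by lra.
  rewrite <- (Rmult_1_l (/ _)) at 2.
  apply Rmult_le_compat_r; [left; now apply Rinv_0_lt_compat|].
  destruct (Nat.even n); apply Rabs_le; [apply SIN_bound | apply COS_bound].
Qed.

Lemma ex_series_clausen (n : nat) (x : R) : (2 <= n)%nat -> ex_series (fun k => clausen_term n k x).
Proof.
  intros Hn. apply (ex_series_le (V := R_CompleteNormedModule) _ (fun k => / INR (S k) ^ n)).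
  - intros k. apply clausen_term_bound.
  - now apply ex_series_inv_pow.
Qed.

Lemma Boule_center (x : R) (r : posreal) : Boule x r x.
Proof. unfold Boule. rewrite Rminus_diag, Rabs_R0. apply cond_pos. Qed.

Lemma Clausen_continuous (n : nat) (x : R) : (2 <= n)%nat -> continuous (Clausen n) x.
Proof.
  intros Hn.
  apply (Series_continuous (fun k x => clausen_term n k x) (fun k => / INR (S k) ^ n) x (mkposreal 1 Rlt_0_1)).
  - apply Boule_center.
  - now apply ex_series_inv_pow.
  - intros; apply clausen_term_bound.
  - intros k y _. unfold clausen_term. apply ex_derive_continuous_R.
    pose proof (INR_S_pos k). generalize dependent (INR (S k)); intros a Ha.
    pose proof (pow_lt a n Ha).
    destruct (Nat.even n); auto_derive; trivial; lra.
Qed.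

(** The sign in the derivative of the Clausen function of index n. *)
Definition clausen_sign (n : nat) : R := if Nat.even n then 1 else -1.

Lemma is_derive_clausen_term (n k : nat) (x : R) :
  is_derive (clausen_term (S n) k) x (clausen_sign (S n) * clausen_term n k x).
Proof.
  unfold clausen_term, clausen_sign. rewrite Nat.even_succ, <- Nat.negb_even.
  pose proof (INR_S_pos k). generalize dependent (INR (S k)); intros a Ha.
  pose proof (pow_lt a n Ha).
  destruct (Nat.even n); simpl; auto_derive; trivial; try nra; field; lra.
Qed.

Lemma is_derive_Clausen (n : nat) (x : R) : (2 <= n)%nat ->
  is_derive (Clausen (S n)) x (clausen_sign (S n) * Clausen n x).
Proof.
  intros Hn. unfold Clausen at 2. rewrite <- Series_scal_l.
  apply (Series_derive (fun k x => clausen_term (S n) k x)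
           (fun k x => clausen_sign (S n) * clausen_term n k x)
           (fun k => / INR (S k) ^ n) x (mkposreal 1 Rlt_0_1)).
  - apply Boule_center.
  - now apply ex_series_inv_pow.
  - intros k y _. rewrite Rabs_mult.
    replace (Rabs (clausen_sign (S n))) with 1.
    + rewrite Rmult_1_l. apply clausen_term_bound.
    + unfold clausen_sign. destruct (Nat.even (S n)); unfold Rabs; destruct (Rcase_abs _); lra.
  - intros; apply is_derive_clausen_term.
  - intros; apply ex_series_clausen; lia.
Qed.

Lemma Clausen_even_0 (n : nat) : Nat.even n = true -> Clausen n 0 = 0.
Proof.
  intros Hn. unfold Clausen. rewrite Hn.
  transitivity (0 * Series (fun k => / INR (S k) ^ n)); [|ring].
  rewrite <- Series_scal_l. apply Series_ext. intros k. rewrite Rmult_0_r, sin_0. reflexivity.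
Qed.

Lemma Clausen_odd_0 (n : nat) : Nat.even n = false -> Clausen n 0 = zeta n.
Proof.
  intros Hn. unfold Clausen, zeta. rewrite Hn.
  apply Series_ext. intros k. rewrite Rmult_0_r, cos_0. unfold Rdiv; ring.
Qed.

(** The derivatives of the partial sums converge only conditionally; their
    convergence is established along the sums with an even number of terms, which
    suffices. *)
Lemma is_derive_Clausen_2_pos (x : R) : 0 < x < 2 * PI ->
  is_derive (Clausen 2) x (- ln (2 * sin (x / 2))).
Proof.
  intros Hx. pose proof PI_RGT_0 as Hpi.
  (* Half of the distance from x to the endpoints 0 and 2 pi. *)
  set (d := Rmin x (2 * PI - x) / 2).
  assert (Hd : 0 < d < PI /\ Rabs (x - PI) < PI - d).
  { unfold d, Rmin. destruct (Rle_dec x (2 * PI - x)); (split; [lra|]); apply Rabs_def1; lra. }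
  destruct Hd as [Hd Hxd].
  destruct (cos_sum_bound d Hd) as (K & HK0 & HK).
  assert (Hr : 0 < PI - d) by lra.
  apply is_derive_Reals.
  apply (CVU_derivable (fun j x => sum_n (fun k => clausen_term 2 k x) (2 * j + 1))
           (fun j x => cos_sum (2 * j + 1) x) _ (fun x => - ln (2 * sin (x / 2)))
           PI (mkposreal _ Hr)); [| | |exact Hxd].
  - assert (HL : is_lim_seq (fun j => K * / INR (S (2 * j + 1))
                                      + Rabs (cos_sum (2 * j + 1) PI + ln 2)) 0).
    { replace (Finite 0) with (Finite (K * 0 + Rabs (- ln 2 + ln 2)))
        by (f_equal; rewrite Rplus_opp_l, Rabs_R0; ring).
      apply is_lim_seq_plus'.
      - apply (is_lim_seq_scal_l _ K 0).
        apply (is_lim_seq_subseq (fun n => / INR n) _ (fun j => S (2 * j + 1))).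
        + apply eventually_subseq. intros n; lia.
        + apply is_lim_seq_inv_INR.
      - apply (is_lim_seq_abs _ (- ln 2 + ln 2)).
        apply is_lim_seq_plus'; [apply cos_sum_PI_lim | apply is_lim_seq_const]. }
    intros eps Heps.
    destruct (proj2 (is_lim_seq_spec _ _) HL (mkposreal eps Heps)) as [N HN].
    exists N. intros j y Hj Hy. specialize (HN j Hj). simpl pos in HN.
    rewrite Rminus_0_r in HN.
    eapply Rle_lt_trans; [|eapply Rle_lt_trans; [apply Rle_abs | exact HN]].
    replace (- ln (2 * sin (y / 2)) - cos_sum (2 * j + 1) y)
      with (- (cos_sum (2 * j + 1) y + ln (2 * sin (y / 2)))) by ring.
    rewrite Rabs_Ropp. apply HK, Hy.
  - intros y _. apply is_lim_seq_Un_cv.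
    apply (is_lim_seq_subseq (sum_n (fun k => clausen_term 2 k y)) _ (fun j => (2 * j + 1)%nat)).
    + apply eventually_subseq. intros n; lia.
    + apply Series_partial_lim, ex_series_clausen; lia.
  - intros j y _. apply is_derive_Reals. unfold cos_sum.
    apply (is_derive_sum_n (fun k => clausen_term 2 k)). intros k _.
    replace (cos (INR (S k) * y) / INR (S k)) with (clausen_sign 2 * clausen_term 1 k y).
    + apply is_derive_clausen_term.
    + unfold clausen_sign, clausen_term. simpl Nat.even. cbv iota. rewrite pow_1. ring.
Qed.

Lemma is_derive_Clausen_2 (x : R) : 0 < Rabs x < 2 * PI ->
  is_derive (Clausen 2) x (- ln (2 * Rabs (sin (x / 2)))).
Proof.
  intros Hx. unfold Rabs in Hx. destruct (Rcase_abs x) as [Hn|Hn].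
  - assert (Hs : 0 < sin (- x / 2)) by (apply sin_gt_0; lra).
    replace (Rabs (sin (x / 2))) with (sin (- x / 2)).
    2:{ replace (- x / 2) with (- (x / 2)) in * by field. rewrite sin_neg in *.
        rewrite Rabs_left; lra. }
    assert (Hodd : forall y, - Clausen 2 (- y) = Clausen 2 y).
    { intros y. unfold Clausen. simpl Nat.even. cbv iota. rewrite <- Series_opp.
      apply Series_ext. intros k. rewrite Ropp_mult_distr_r_reverse, sin_neg.
      unfold Rdiv. ring. }
    apply (is_derive_ext (fun y => - Clausen 2 (- y))); [exact Hodd|].
    pose proof (is_derive_Clausen_2_pos (- x) Hx) as H.
    auto_derive.
    + eexists; exact H.
    + replace (Derive (fun x0 => Clausen 2 x0) (- x)) with (- ln (2 * sin (- x / 2)))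
        by (symmetry; apply is_derive_unique, H).
      ring.
  - rewrite (Rabs_pos_eq (sin _)) by (left; apply sin_gt_0; lra).
    now apply is_derive_Clausen_2_pos.
Qed.

(** * The expansion of log Gamma *)

(** Term of exponent N + j, where N = 2n + 3, of the j-fold integral from 0 of the
    series of zeta(N) t^N / N: the coefficient is zeta(N) (N-1)! / (N+j)!. *)
Definition odd_zeta_term (j n : nat) (t : R) : R :=
  zeta (2 * n + 3) * (INR (fact (2 * n + 2)) / INR (fact (2 * n + 3 + j))) * t ^ (2 * n + 3 + j).

Definition odd_zeta_series (j : nat) (t : R) : R := Series (fun n => odd_zeta_term j n t).

Lemma INR_fact_pos (n : nat) : 0 < INR (fact n).
Proof. apply INR_fact_lt_0. Qed.

Lemma Rabs_pow_le (r t : R) (a b : nat) : Rabs t <= r -> 0 <= r <= 1 -> (b <= a)%nat ->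
  Rabs (t ^ a) <= r ^ b.
Proof.
  intros Ht Hr Hab. rewrite <- RPow_abs.
  apply Rle_trans with (r ^ a); [apply pow_incr; split; [apply Rabs_pos | assumption]|].
  replace a with (b + (a - b))%nat by lia. rewrite pow_add.
  rewrite <- (Rmult_1_r (r ^ b)) at 2. apply Rmult_le_compat_l; [apply pow_le; lra|].
  rewrite <- (pow1 (a - b)). apply pow_incr; lra.
Qed.

Lemma odd_zeta_term_bound (j n : nat) (r t : R) : Rabs t <= r -> 0 <= r <= 1 ->
  Rabs (odd_zeta_term j n t) <= zeta 3 * r ^ n.
Proof.
  intros Ht Hr. unfold odd_zeta_term.
  pose proof (zeta_pos (2 * n + 3) ltac:(lia)) as Hz.
  pose proof (zeta_le (2 * n + 3) 3 ltac:(lia) ltac:(lia)) as Hz3.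
  assert (Hq : 0 <= INR (fact (2 * n + 2)) / INR (fact (2 * n + 3 + j)) <= 1).
  { pose proof (INR_fact_pos (2 * n + 2)). pose proof (INR_fact_pos (2 * n + 3 + j)).
    assert (INR (fact (2 * n + 2)) <= INR (fact (2 * n + 3 + j))) by (apply le_INR, fact_le; lia).
    split; [apply Rdiv_le_0_compat; lra|].
    apply (Rmult_le_reg_r (INR (fact (2 * n + 3 + j)))); [assumption|].
    unfold Rdiv. rewrite Rmult_assoc, Rinv_l by lra. lra. }
  rewrite Rabs_mult, Rabs_pos_eq by (apply Rmult_le_pos; lra).
  apply Rmult_le_compat; [apply Rmult_le_pos; lra | apply Rabs_pos | | apply Rabs_pow_le; auto; lia].
  rewrite <- (Rmult_1_r (zeta 3)). apply Rmult_le_compat; lra.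
Qed.

Lemma ex_series_scal_geom (c q : R) : 0 <= q < 1 -> ex_series (fun n => c * q ^ n).
Proof.
  intros Hq. apply (ex_series_scal_l (V := R_NormedModule) c (fun n => q ^ n)).
  now apply ex_series_geom_pos.
Qed.

Lemma ex_series_odd_zeta (j : nat) (t : R) : Rabs t < 1 -> ex_series (fun n => odd_zeta_term j n t).
Proof.
  intros Ht. pose proof (Rabs_pos t).
  apply (ex_series_le (V := R_CompleteNormedModule) _ (fun n => zeta 3 * Rabs t ^ n)).
  - intros n. apply odd_zeta_term_bound; lra.
  - apply ex_series_scal_geom; lra.
Qed.

Lemma interior_radius (t : R) : Rabs t < 1 -> exists r : posreal, r < 1 /\ Boule 0 r t.
Proof.
  intros Ht. assert (Hr : 0 < (1 + Rabs t) / 2) by (pose proof (Rabs_pos t); lra).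
  exists (mkposreal _ Hr). unfold Boule; simpl. rewrite Rminus_0_r. lra.
Qed.

Lemma is_derive_odd_zeta (j : nat) (t : R) : Rabs t < 1 ->
  is_derive (odd_zeta_series (S j)) t (odd_zeta_series j t).
Proof.
  intros Ht. destruct (interior_radius t Ht) as (r & Hr1 & Hr). pose proof (cond_pos r).
  apply (Series_derive (fun n t => odd_zeta_term (S j) n t) (fun n t => odd_zeta_term j n t)
           (fun n => zeta 3 * r ^ n) 0 r); [assumption | | | |].
  - apply ex_series_scal_geom; lra.
  - intros n y Hy. unfold Boule in Hy. rewrite Rminus_0_r in Hy.
    apply odd_zeta_term_bound; lra.
  - intros n y _. unfold odd_zeta_term.
    replace (2 * n + 3 + S j)%nat with (S (2 * n + 3 + j)) by lia.
    rewrite fact_simpl, mult_INR.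
    pose proof (INR_S_pos (2 * n + 3 + j)). pose proof (INR_fact_pos (2 * n + 3 + j)).
    generalize (zeta (2 * n + 3)) (INR (fact (2 * n + 2))).
    generalize dependent (2 * n + 3 + j)%nat. intros N HN HF c d.
    auto_derive; [trivial|].
    change (match N with O => 1 | S _ => INR N + 1 end) with (INR (S N)).
    field. lra.
  - intros y Hy. apply ex_series_odd_zeta. unfold Boule in Hy. rewrite Rminus_0_r in Hy. lra.
Qed.

Lemma odd_zeta_continuous (j : nat) (t : R) : Rabs t < 1 -> continuous (odd_zeta_series j) t.
Proof.
  intros Ht. destruct (interior_radius t Ht) as (r & Hr1 & Hr). pose proof (cond_pos r).
  apply (Series_continuous (fun n t => odd_zeta_term j n t) (fun n => zeta 3 * r ^ n) 0 r);
    [assumption | | |].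
  - apply ex_series_scal_geom; lra.
  - intros n y Hy. unfold Boule in Hy. rewrite Rminus_0_r in Hy.
    apply odd_zeta_term_bound; lra.
  - intros n y _. apply ex_derive_continuous_R. unfold odd_zeta_term. auto_derive; trivial.
Qed.

Lemma odd_zeta_series_0 (j : nat) : odd_zeta_series j 0 = 0.
Proof.
  unfold odd_zeta_series.
  transitivity (0 * Series (fun n => odd_zeta_term j n 0)); [|ring].
  rewrite <- Series_scal_l. apply Series_ext. intros n. unfold odd_zeta_term.
  rewrite pow_i by lia. ring.
Qed.

(** The odd part of log (1 + x), without its linear term. *)
Definition artanh_tail (x : R) : R := (ln (1 + x) - ln (1 - x)) / 2 - x.

(** Both sides vanish at 0 and have derivative x^2 / (1 - x^2). *)
Lemma artanh_series (x : R) : Rabs x < 1 ->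
  is_series (fun n => x ^ (2 * n + 3) / INR (2 * n + 3)) (artanh_tail x).
Proof.
  set (term := fun n x => x ^ (2 * n + 3) / INR (2 * n + 3)).
  assert (HI : forall n, 1 <= INR (2 * n + 3)).
  { intros n. rewrite plus_INR. pose proof (pos_INR (2 * n)). simpl (INR 3). lra. }
  assert (Hex : forall y, Rabs y < 1 -> ex_series (fun n => term n y)).
  { intros y Hy. pose proof (Rabs_pos y).
    apply (ex_series_le (V := R_CompleteNormedModule) _ (fun n => Rabs y ^ n)).
    - intros n. change (Rabs (term n y) <= Rabs y ^ n). unfold term, Rdiv.
      specialize (HI n).
      rewrite Rabs_mult, Rabs_inv, (Rabs_pos_eq (INR _)) by lra.
      rewrite <- (Rmult_1_r (Rabs y ^ n)).
      apply Rmult_le_compat; [apply Rabs_pos | left; apply Rinv_0_lt_compat; lra | |].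
      + apply Rabs_pow_le; lra || lia.
      + rewrite <- Rinv_1. apply Rinv_le_contravar; lra.
    - apply ex_series_geom_pos; lra. }
  assert (Hd : forall y, Rabs y < 1 ->
            is_derive (fun y => Series (fun n => term n y) - artanh_tail y) y 0).
  { intros y Hy. destruct (interior_radius y Hy) as (r & Hr1 & Hr). pose proof (cond_pos r).
    assert (Hy2 : 0 <= y ^ 2 < 1).
    { split; [apply pow2_ge_0|]. pose proof (one_minus_sq_pos y Hy). lra. }
    assert (HS : Series (fun n => y ^ (2 * n + 2)) = y ^ 2 / (1 - y ^ 2)).
    { transitivity (Series (fun n => y ^ 2 * (y ^ 2) ^ n)).
      - apply Series_ext. intros n. rewrite pow_add, pow_mult. ring.
      - rewrite Series_scal_l. unfold Rdiv. f_equal.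
        apply Series_geom. rewrite Rabs_pos_eq; lra. }
    replace 0 with (minus (Series (fun n => y ^ (2 * n + 2))) (y ^ 2 / (1 - y ^ 2)))
      by (rewrite HS; apply Rminus_diag).
    apply (is_derive_minus (K := R_AbsRing) (V := R_NormedModule)
             (fun y => Series (fun n => term n y)) artanh_tail).
    - apply (Series_derive term (fun n y => y ^ (2 * n + 2)) (fun n => r ^ n) 0 r);
        [assumption | | | |].
      + apply ex_series_geom_pos; lra.
      + intros n z Hz. unfold Boule in Hz. rewrite Rminus_0_r in Hz.
        apply Rabs_pow_le; lra || lia.
      + intros n z _. unfold term. specialize (HI n).
        replace (2 * n + 3)%nat with (S (2 * n + 2)) in * by lia.
        generalize dependent (2 * n + 2)%nat. intros N HN.
        auto_derive; [trivial|].
        change (match N with O => 1 | S _ => INR N + 1 end) with (INR (S N)) in *.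
        field. lra.
      + intros z Hz. apply Hex. unfold Boule in Hz. rewrite Rminus_0_r in Hz. lra.
    - unfold artanh_tail. apply Rabs_def2 in Hy. auto_derive; [lra|]. field. simpl in *. nra. }
  intros Hx.
  assert (E : Series (fun n => term n x) - artanh_tail x = 0).
  { destruct (MVT_gen (fun y => Series (fun n => term n y) - artanh_tail y) 0 x (fun _ => 0))
      as (c & _ & E).
    - intros y Hy. apply Hd. apply Rabs_def2 in Hx. unfold Rmin, Rmax in Hy.
      destruct (Rle_dec 0 x); apply Rabs_def1; lra.
    - intros y Hy. apply ex_derive_continuity_pt. eexists. apply Hd.
      apply Rabs_def2 in Hx. unfold Rmin, Rmax in Hy.
      destruct (Rle_dec 0 x); apply Rabs_def1; lra.
    - assert (E0 : Series (fun n => term n 0) = 0).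
      { transitivity (0 * Series (fun n => term n 0)); [|ring].
        rewrite <- Series_scal_l. apply Series_ext. intros n. unfold term.
        rewrite pow_i by lia. unfold Rdiv. ring. }
      assert (E1 : artanh_tail 0 = 0).
      { unfold artanh_tail. rewrite Rplus_0_r, !Rminus_0_r, Rminus_diag. field. }
      rewrite E0, E1 in E. lra. }
  replace (artanh_tail x) with (Series (fun n => term n x)) by lra.
  apply Series_correct, Hex, Hx.
Qed.

Definition partial_zeta (K s : nat) : R := sum_n (fun k => / INR (S k) ^ s) K.

Lemma sum_artanh_series (t : R) (K : nat) : Rabs t < 1 ->
  is_series (fun n => partial_zeta K (2 * n + 3) * t ^ (2 * n + 3) / INR (2 * n + 3))
    (sum_n (fun k => artanh_tail (t / INR (S k))) K).
Proof.
  intros Ht.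
  assert (E : forall n k, (t / INR (S k)) ^ (2 * n + 3) / INR (2 * n + 3)
            = / INR (S k) ^ (2 * n + 3) * t ^ (2 * n + 3) / INR (2 * n + 3)).
  { intros n k. unfold Rdiv. rewrite Rpow_mult_distr, pow_inv. ring. }
  induction K as [|K IH].
  - rewrite sum_O. eapply is_series_ext; [|apply artanh_series, ratio_lt_1, Ht].
    intros n. cbv beta. rewrite (E n 0%nat). unfold partial_zeta. now rewrite sum_O.
  - rewrite sum_Sn.
    pose proof (is_series_plus (V := R_NormedModule) _ _ _ _ IH
                  (artanh_series (t / INR (S (S K))) (ratio_lt_1 t (S K) Ht))) as HP.
    eapply is_series_ext; [|exact HP].
    intros n.
    transitivity (partial_zeta K (2 * n + 3) * t ^ (2 * n + 3) / INR (2 * n + 3)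
                  + (t / INR (S (S K))) ^ (2 * n + 3) / INR (2 * n + 3)); [reflexivity|].
    rewrite E. unfold partial_zeta. rewrite sum_Sn. change plus with Rplus.
    eq_real. unfold Rdiv. ring.
Qed.

(** Interchanging the two summations in the sum over k and n of
    (t / k) ^ (2 n + 3) / (2 n + 3). *)
Lemma sum_artanh_lim (t : R) : Rabs t < 1 ->
  is_lim_seq (sum_n (fun k => artanh_tail (t / INR (S k)))) (odd_zeta_series 0 t).
Proof.
  intros Ht. pose proof (Rabs_pos t) as Ht0.
  set (G := Series (fun n => Rabs t ^ n)).
  assert (HG : forall c, Series (fun n => c * Rabs t ^ n) = c * G)
    by (intros; apply Series_scal_l).
  assert (Hdiff : forall K, Rabs (sum_n (fun k => artanh_tail (t / INR (S k))) K
                                  - odd_zeta_series 0 t)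
                            <= (zeta 3 - partial_zeta K 3) * G).
  { intros K.
    pose proof (sum_artanh_series t K Ht) as HS.
    pose proof (Series_correct _ (ex_series_odd_zeta 0 t Ht)) as HZ.
    assert (HD : is_series (fun n => partial_zeta K (2 * n + 3) * t ^ (2 * n + 3) / INR (2 * n + 3)
                                     - odd_zeta_term 0 n t)
                   (sum_n (fun k => artanh_tail (t / INR (S k))) K - odd_zeta_series 0 t))
      by exact (is_series_minus (V := R_NormedModule) _ _ _ _ HS HZ).
    rewrite <- (is_series_unique _ _ HD), <- HG.
    assert (Hb : forall n, Rabs (partial_zeta K (2 * n + 3) * t ^ (2 * n + 3) / INR (2 * n + 3)
                              - odd_zeta_term 0 n t) <= (zeta 3 - partial_zeta K 3) * Rabs t ^ n).
    { intros n.
      assert (HI : 1 <= INR (2 * n + 3)).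
      { rewrite plus_INR. pose proof (pos_INR (2 * n)). simpl (INR 3). lra. }
      assert (E : partial_zeta K (2 * n + 3) * t ^ (2 * n + 3) / INR (2 * n + 3)
                    - odd_zeta_term 0 n t
                  = (zeta (2 * n + 3) - partial_zeta K (2 * n + 3)) * (- t ^ (2 * n + 3) / INR (2 * n + 3))).
      { unfold odd_zeta_term. rewrite Nat.add_0_r.
        replace (fact (2 * n + 3)) with ((2 * n + 3) * fact (2 * n + 2))%nat
          by (replace (2 * n + 3)%nat with (S (2 * n + 2)) by lia; reflexivity).
        rewrite mult_INR. pose proof (INR_fact_pos (2 * n + 2)).
        field. lra. }
      rewrite E, Rabs_mult.
      apply Rmult_le_compat; [apply Rabs_pos | apply Rabs_pos | |].
      - apply (Series_tail_le (fun k => / INR (S k) ^ (2 * n + 3)) (fun k => / INR (S k) ^ 3)).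
        + apply ex_series_inv_pow; lia.
        + intros k. rewrite Rabs_pos_eq by (left; apply Rinv_0_lt_compat, pow_lt, INR_S_pos).
          apply inv_pow_le; lia.
      - unfold Rdiv. rewrite Rabs_mult, Rabs_Ropp, Rabs_inv, (Rabs_pos_eq (INR _)) by lra.
        rewrite <- (Rmult_1_r (Rabs t ^ n)).
        apply Rmult_le_compat; [apply Rabs_pos | left; apply Rinv_0_lt_compat; lra | |].
        + apply Rabs_pow_le; lra || lia.
        + rewrite <- Rinv_1. apply Rinv_le_contravar; lra. }
    assert (Hc : ex_series (fun n => (zeta 3 - partial_zeta K 3) * Rabs t ^ n))
      by (apply ex_series_scal_geom; lra).
    eapply Rle_trans; [apply Series_Rabs | apply Series_le; [|exact Hc]].
    - apply (ex_series_le (V := R_CompleteNormedModule) _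
               (fun n => (zeta 3 - partial_zeta K 3) * Rabs t ^ n)); [|exact Hc].
      intros n. eapply Rle_trans; [|apply Hb]. right. apply Rabs_Rabsolu.
    - intros n; split; [apply Rabs_pos | apply Hb]. }
  assert (HL : is_lim_seq (fun K => (zeta 3 - partial_zeta K 3) * G) 0).
  { replace (Finite 0) with (Finite ((zeta 3 - zeta 3) * G)) by (f_equal; ring).
    apply is_lim_seq_mult'; [|apply is_lim_seq_const].
    apply is_lim_seq_minus'; [apply is_lim_seq_const|].
    apply Series_partial_lim, ex_series_inv_pow; lia. }
  apply (is_lim_seq_le_le
    (fun K => odd_zeta_series 0 t - (zeta 3 - partial_zeta K 3) * G) _
    (fun K => odd_zeta_series 0 t + (zeta 3 - partial_zeta K 3) * G)).
  - intros K. specialize (Hdiff K). apply Rabs_le_between in Hdiff. lra.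
  - replace (Finite (odd_zeta_series 0 t)) with (Finite (odd_zeta_series 0 t - 0)) by (f_equal; ring).
    apply is_lim_seq_minus'; [apply is_lim_seq_const | exact HL].
  - replace (Finite (odd_zeta_series 0 t)) with (Finite (odd_zeta_series 0 t + 0)) by (f_equal; ring).
    apply is_lim_seq_plus'; [apply is_lim_seq_const | exact HL].
Qed.

(** In the logarithm of Gauss's product, log (1 + t/k) is the sum of t/k, of half
    of log (1 - t^2/k^2), and of an odd tail: these produce the Euler constant, the
    sine and the zeta series. *)
Lemma logGamma_expansion (t : R) : 0 < Rabs t < 1 ->
  logGamma t = - euler_mascheroni * t - ln (Rabs t)
               - ln (sin (PI * t) / (PI * t)) / 2 - odd_zeta_series 0 t.
Proof.
  intros Ht.
  assert (H : is_lim_seq (fun n => t * ln (INR (S n)) - ln (Rabs t) - log_rising t n)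
    (- euler_mascheroni * t - ln (Rabs t)
               - ln (sin (PI * t) / (PI * t)) * / 2 - odd_zeta_series 0 t)).
  { apply (is_lim_seq_ext (fun n =>
      - (harmonic (S n) - ln (INR (S n))) * t - ln (Rabs t)
      - sum_n (fun k => ln (1 - (t / INR (S k)) ^ 2)) n * / 2
      - sum_n (fun k => artanh_tail (t / INR (S k))) n)).
    - intros n.
      assert (E : log_rising t n = harmonic (S n) * t
         + sum_n (fun k => ln (1 - (t / INR (S k)) ^ 2)) n * / 2
         + sum_n (fun k => artanh_tail (t / INR (S k))) n).
      { assert (P : forall x, Rabs x < 1 ->
                  ln (1 + x) = x + ln (1 - x ^ 2) * / 2 + artanh_tail x).
        { intros x Hx. apply Rabs_def2 in Hx. unfold artanh_tail.
          replace (1 - x ^ 2) with ((1 + x) * (1 - x)) by ring.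
          rewrite ln_mult by lra. field. }
        induction n as [|n IH].
        - unfold log_rising. rewrite harmonic_S, harmonic_0, !sum_O, P by (now apply ratio_lt_1).
          unfold Rdiv. ring.
        - rewrite log_rising_S, IH, (harmonic_S (S n)), !sum_Sn, P by (now apply ratio_lt_1).
          change plus with Rplus. unfold Rdiv. ring. }
      rewrite E. ring.
    - apply is_lim_seq_minus'; [|now apply sum_artanh_lim].
      apply is_lim_seq_minus'.
      + apply is_lim_seq_minus'; [|apply is_lim_seq_const].
        apply is_lim_seq_mult'; [|apply is_lim_seq_const].
        apply (is_lim_seq_opp _ euler_mascheroni), euler_mascheroni_lim.
      + apply is_lim_seq_mult'; [now apply ln_sine_product | apply is_lim_seq_const]. }
  pose proof (is_lim_seq_unique _ _ (logGamma_product t Ht)) as E1.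
  rewrite (is_lim_seq_unique _ _ H) in E1. injection E1 as E1. symmetry. exact E1.
Qed.

(** * Negapolygammas as iterated antiderivatives *)

Lemma is_derive_taylor_kernel (a : nat) (z t : R) :
  is_derive (fun t => (z - t) ^ S a / INR (fact (S a))) t (- ((z - t) ^ a / INR (fact a))).
Proof.
  rewrite fact_simpl, mult_INR.
  pose proof (INR_fact_pos a) as Hf. pose proof (INR_S_pos a) as HS.
  generalize dependent (INR (fact a)). intros F HF.
  auto_derive; [trivial|].
  change (match a with O => 1 | S _ => INR a + 1 end) with (INR (S a)).
  unfold Rminus. field. lra.
Qed.

(** The antiderivative is the sum over i <= a of
    (z - t) ^ (a - i) / (a - i)! times the i-th member b (i + 1) of the chain; at
    t = z only the last term survives, and at 0 all of them vanish. *)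
Lemma iterated_parts (a : nat) : forall (b : nat -> R -> R) (z : R),
  (forall i t, 0 < Rabs t < 1 -> is_derive (b (S i)) t (b i t)) ->
  (forall i, (i <= a)%nat -> filterlim (b (S i)) (locally' 0) (locally 0)) ->
  exists G : R -> R,
    (forall t, 0 < Rabs t < 1 -> is_derive G t ((z - t) ^ a / INR (fact a) * b 0%nat t)) /\
    G z = b (S a) z /\ filterlim G (locally' 0) (locally 0).
Proof.
  induction a as [|a IH]; intros b z Hd Hl.
  - exists (b 1%nat). split; [|split; [reflexivity|]].
    + intros t Ht. replace (_ * _) with (b 0%nat t) by (simpl; field). now apply Hd.
    + now apply Hl.
  - destruct (IH (fun i => b (S i)) z) as (G & HG & HGz & HGl).
    + intros i t Ht; now apply Hd.
    + intros i Hi; apply Hl; lia.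
    + exists (fun t => (z - t) ^ S a / INR (fact (S a)) * b 1%nat t + G t). split; [|split].
      * intros t Ht.
        pose proof (is_derive_taylor_kernel a z t) as Hp.
        pose proof (is_derive_mult _ _ t _ _ Hp (Hd 0%nat t Ht) Rmult_comm) as Hm.
        pose proof (is_derive_plus _ _ t _ _ Hm (HG t Ht)) as HP.
        match type of HP with is_derive _ _ ?l =>
          replace (_ * b 0%nat t) with l; [exact HP|] end.
        unfold plus, mult; simpl. ring.
      * rewrite HGz, Rminus_diag, pow_i by lia. unfold Rdiv. ring.
      * replace 0 with ((z - 0) ^ S a / INR (fact (S a)) * 0 + 0) at 2 by ring.
        apply (filterlim_comp_2 (F := locally' 0) (H := locally 0)
          (G := locally ((z - 0) ^ S a / INR (fact (S a)) * 0))
          (fun t => (z - t) ^ S a / INR (fact (S a)) * b 1%nat t) G Rplus);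
          [|exact HGl|apply (filterlim_plus (V := R_NormedModule))].
        apply (filterlim_comp_2 (F := locally' 0) (H := locally 0)
          (G := locally ((z - 0) ^ S a / INR (fact (S a))))
          (fun t => (z - t) ^ S a / INR (fact (S a))) (b 1%nat) Rmult);
          [|apply Hl; lia|apply (filterlim_mult (K := R_AbsRing))].
        eapply filterlim_filter_le_1; [apply filter_le_within|].
        apply (ex_derive_continuous_R (fun t => (z - t) ^ S a / INR (fact (S a)))).
        auto_derive; trivial.
Qed.

Lemma punctured_segment (x z t : R) : 0 < x * z -> Rabs x <= 1 -> Rabs z < 1 -> Rabs x < Rabs z ->
  Rmin x z <= t <= Rmax x z -> 0 < Rabs t < 1.
Proof.
  intros Hxz Hx Hz Hxlz Ht.
  unfold Rmin, Rmax in Ht. destruct (Rle_dec x z);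
    unfold Rabs in *; destruct (Rcase_abs x), (Rcase_abs z), (Rcase_abs t); try lra; split; nra.
Qed.

Lemma endpoint0_near (z : R) (P : R -> Prop) : 0 < Rabs z ->
  (forall x, 0 < x * z -> Rabs x < Rabs z -> P x) -> endpoint0 z P.
Proof.
  intros Hz H. unfold endpoint0. destruct (Rlt_dec 0 z) as [Hp|Hn];
    exists (mkposreal _ Hz); intros y Hy Hy0; apply H;
    change (Rabs (y - 0) < Rabs z) in Hy; rewrite Rminus_0_r in Hy; try assumption.
  - nra.
  - unfold Rabs in Hz; destruct (Rcase_abs z); nra.
Qed.

Lemma endpoint0_filter (z : R) : ProperFilter (endpoint0 z).
Proof. unfold endpoint0; destruct (Rlt_dec 0 z); typeclasses eauto. Qed.

Lemma endpoint0_le_locally' (z : R) : filter_le (endpoint0 z) (locally' 0).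
Proof.
  intros P [d Hd]. unfold endpoint0.
  destruct (Rlt_dec 0 z); exists d; intros y Hy Hy0; apply Hd; auto; lra.
Qed.

(** Repeated integration by parts: an antiderivative chain of log Gamma that
    vanishes at 0 consists of the negapolygammas. *)
Lemma negapolygamma_chain (b : nat -> R -> R) (a : nat) (z : R) : 0 < Rabs z < 1 ->
  (forall i t, 0 < Rabs t < 1 -> is_derive (b (S i)) t (b i t)) ->
  (forall i, (i <= a)%nat -> filterlim (b (S i)) (locally' 0) (locally 0)) ->
  (forall t, 0 < Rabs t < 1 -> continuous (b 0%nat) t) ->
  (forall t, 0 < Rabs t < 1 -> b 0%nat t = logGamma t) ->
  negapolygamma (a + 2) z = b (S a) z.
Proof.
  intros Hz Hd Hl Hc Hb0.
  destruct (iterated_parts a b z Hd Hl) as (G & HG & HGz & HGl).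
  pose proof (INR_fact_pos a) as Hf.
  pose proof (endpoint0_filter z) as HF.
  assert (Hseg : forall (P : R * R -> Prop),
     (forall x, 0 < x * z -> Rabs x < Rabs z -> P (x, z)) ->
     filter_prod (endpoint0 z) (at_point z) P).
  { intros P HP. exists (fun x => 0 < x * z /\ Rabs x < Rabs z) (fun y => y = z).
    - apply endpoint0_near; [lra|auto].
    - reflexivity.
    - intros x y [H1 H2] ->. now apply HP. }
  assert (HI : is_RInt_gen (fun t => (z - t) ^ a / INR (fact a) * b 0%nat t)
                 (endpoint0 z) (at_point z) (G z - 0)).
  { apply (is_RInt_gen_antiderivative _ _ _ G).
    - apply Hseg. intros x Hx Hxz t Ht; simpl in Ht.
      assert (Ht' : 0 < Rabs t < 1) by (apply (punctured_segment x z t); lra).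
      split; [now apply HG|].
      apply (continuous_mult (K := R_AbsRing) (fun t => (z - t) ^ a / INR (fact a)) (b 0%nat));
        [|now apply Hc].
      apply ex_derive_continuous_R. auto_derive; trivial.
    - exact (filterlim_filter_le_1 _ (endpoint0_le_locally' z) HGl).
    - intros P HP. exact (locally_singleton (G z) P HP). }
  pose proof (is_RInt_gen_scal (V := R_NormedModule) _ (INR (fact a)) _ HI) as HI'.
  unfold negapolygamma. replace (a + 2 - 2)%nat with a by lia.
  assert (HE : is_RInt_gen (fun t => (z - t) ^ a * logGamma t)
                 (endpoint0 z) (at_point z) (INR (fact a) * b (S a) z)).
  { replace (INR (fact a) * b (S a) z) with (scal (INR (fact a)) (G z - 0))
      by (rewrite HGz, Rminus_0_r; reflexivity).
    revert HI'. apply (is_RInt_gen_ext (V := R_NormedModule)).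
    apply Hseg. intros x Hx Hxz t Ht; simpl in Ht.
    rewrite <- Hb0 by (apply (punctured_segment x z t); lra).
    unfold scal; simpl; unfold mult; simpl. field. lra. }
  rewrite (is_RInt_gen_unique (V := R_CompleteNormedModule) _ _ HE).
  field. lra.
Qed.

(** The divided power t ^ (j - s) / (j - s)!, read as 0 when j < s, so that
    the derivative of the one of index j + 1 is always the one of index j. *)
Definition dpow (s j : nat) (t : R) : R :=
  if (s <=? j)%nat then t ^ (j - s) / INR (fact (j - s)) else 0.

Lemma is_derive_dpow (s j : nat) (t : R) : is_derive (dpow s (S j)) t (dpow s j t).
Proof.
  unfold dpow. destruct (Nat.leb_spec s (S j)) as [H|H].
  - destruct (Nat.leb_spec s j) as [H'|H'].
    + replace (S j - s)%nat with (S (j - s)) by lia.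
      rewrite fact_simpl, mult_INR.
      pose proof (INR_S_pos (j - s)). pose proof (INR_fact_pos (j - s)).
      generalize dependent (j - s)%nat. intros N HN HF.
      auto_derive; [trivial|].
      change (match N with O => 1 | S _ => INR N + 1 end) with (INR (S N)). field. lra.
    + replace (S j - s)%nat with 0%nat by lia. simpl. apply (is_derive_const (V := R_NormedModule) (1 / 1)).
  - destruct (Nat.leb_spec s j) as [H'|H']; [lia|]. apply (is_derive_const (V := R_NormedModule) 0).
Qed.

Lemma dpow_at_0 (s j : nat) : s <> j -> dpow s j 0 = 0.
Proof.
  intros H. unfold dpow. destruct (Nat.leb_spec s j); [|reflexivity].
  rewrite pow_i by lia. unfold Rdiv; ring.
Qed.

Lemma dpow_diag (j : nat) (t : R) : dpow j j t = 1.
Proof. unfold dpow. rewrite Nat.leb_refl, Nat.sub_diag. simpl. field. Qed.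

(** The j-fold integral from 0 of log |t|. *)
Definition log_part (j : nat) (t : R) : R := dpow 0 j t * (ln (Rabs t) - harmonic j).

(** Writing log |t| as log (t ^ 2) / 2 avoids a case distinction on the sign. *)
Lemma is_derive_ln_Rabs (t : R) : t <> 0 -> is_derive (fun t => ln (Rabs t)) t (/ t).
Proof.
  intros Ht.
  apply (is_derive_ext (fun t => ln (t ^ 2) / 2)).
  - intros u. rewrite <- (pow2_abs u).
    destruct (Req_dec u 0) as [->|Hu].
    + rewrite Rabs_R0, pow_ne_zero by lia.
      (* At 0 both expressions take the default value ln 0 = 0. *)
      assert (ln 0 = 0); [|lra].
      unfold ln. destruct (Rlt_dec 0 0) as [H|H]; [exfalso; lra | reflexivity].
    + pose proof (Rabs_pos_lt u Hu). simpl. rewrite Rmult_1_r, ln_mult by assumption. field.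
  - auto_derive; [pose proof (pow2_gt_0 t Ht); simpl in *; lra|]. field. assumption.
Qed.

Lemma is_derive_log_part (j : nat) (t : R) : t <> 0 ->
  is_derive (log_part (S j)) t (log_part j t).
Proof.
  intros Ht. unfold log_part.
  assert (Hl : is_derive (fun t => ln (Rabs t) - harmonic (S j)) t (/ t)).
  { replace (/ t) with (minus (/ t) 0) by (apply Rminus_0_r).
    apply (is_derive_minus (K := R_AbsRing) (V := R_NormedModule) (fun t => ln (Rabs t)) (fun _ => harmonic (S j))).
    - now apply is_derive_ln_Rabs.
    - apply (is_derive_const (V := R_NormedModule)). }
  pose proof (is_derive_mult _ _ t _ _ (is_derive_dpow 0 j t) Hl Rmult_comm) as Hm.
  match type of Hm with is_derive _ _ ?l => replace (dpow 0 j t * _) with l; [exact Hm|] end.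
  rewrite harmonic_S. unfold plus, mult; simpl.
  assert (E : dpow 0 (S j) t = t * dpow 0 j t / INR (S j)).
  { unfold dpow. simpl Nat.leb. cbv iota. rewrite !Nat.sub_0_r, fact_simpl, mult_INR.
    pose proof (INR_S_pos j). pose proof (INR_fact_pos j). simpl pow. field. lra. }
  rewrite E. pose proof (INR_S_pos j).
  change (match j with O => 1 | S _ => INR j + 1 end) with (INR (S j)). field. lra.
Qed.

(** With w the square root of |t|, the inequality log (1 / w) <= 1 / w - 1 gives
    |t log |t|| <= 2 w. *)
Lemma filterlim_xln_0 : filterlim (fun t => t * ln (Rabs t)) (locally' 0) (locally 0).
Proof.
  apply filterlim_locally. intros eps. pose proof (cond_pos eps) as He.
  assert (Hd : 0 < Rmin 1 ((eps / 2) ^ 2)).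
  { apply Rmin_glb_lt; [lra|]. apply pow_lt. lra. }
  exists (mkposreal _ Hd). intros t Ht Ht0.
  change (Rabs (t - 0) < Rmin 1 ((eps / 2) ^ 2)) in Ht. rewrite Rminus_0_r in Ht.
  change (Rabs (t * ln (Rabs t) - 0) < eps). rewrite Rminus_0_r, Rabs_mult.
  pose proof (Rabs_pos_lt t Ht0) as Hp.
  pose proof (Rmin_l 1 ((eps / 2) ^ 2)). pose proof (Rmin_r 1 ((eps / 2) ^ 2)).
  set (u := Rabs t) in *.
  set (w := sqrt u).
  assert (Hw : 0 < w) by now apply sqrt_lt_R0.
  assert (Hwu : w * w = u) by (apply sqrt_sqrt; lra).
  assert (Hwe : w < eps / 2) by (apply Rsqr_incrst_0; unfold Rsqr; lra).
  assert (H1 : ln (/ w) <= / w - 1) by (apply ln_le_sub_1; now apply Rinv_0_lt_compat).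
  rewrite ln_Rinv in H1 by assumption.
  assert (Hlu : ln u = 2 * ln w) by (rewrite <- Hwu, ln_mult by assumption; ring).
  assert (Hlneg : ln u <= 0) by (rewrite <- ln_1; apply ln_le; lra).
  rewrite Rabs_left1 by assumption.
  assert (- ln u <= 2 * / w) by lra.
  apply Rle_lt_trans with (u * (2 * / w)); [apply Rmult_le_compat_l; lra|].
  replace (u * (2 * / w)) with (2 * w) by (rewrite <- Hwu; field; lra). lra.
Qed.

Lemma filterlim_continuous_punctured (f : R -> R) (l : R) : continuous f 0 -> f 0 = l ->
  filterlim f (locally' 0) (locally l).
Proof.
  intros Hf <-. eapply filterlim_filter_le_1; [apply filter_le_within|]. exact Hf.
Qed.

Lemma log_part_lim_0 (j : nat) : filterlim (log_part (S j)) (locally' 0) (locally 0).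
Proof.
  pose proof (INR_fact_pos (S j)) as Hf.
  apply (filterlim_ext (fun t => t ^ j / INR (fact (S j)) * (t * ln (Rabs t))
                                 + - (harmonic (S j) * (t ^ S j / INR (fact (S j)))))).
  - intros t. unfold log_part, dpow. simpl Nat.leb. cbv iota. rewrite Nat.sub_0_r.
    simpl pow. field. lra.
  - replace 0 with (0 ^ j / INR (fact (S j)) * 0 + 0) at 2 by ring.
    apply (filterlim_comp_2 (F := locally' 0) (H := locally 0)
          (G := locally (0 ^ j / INR (fact (S j)) * 0))
          (fun t => t ^ j / INR (fact (S j)) * (t * ln (Rabs t))) _ Rplus);
      [| |apply (filterlim_plus (V := R_NormedModule))].
    + apply (filterlim_comp_2 (F := locally' 0) (H := locally 0)
          (G := locally (0 ^ j / INR (fact (S j))))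
          (fun t => t ^ j / INR (fact (S j))) (fun t => t * ln (Rabs t)) Rmult);
        [|apply filterlim_xln_0|apply (filterlim_mult (K := R_AbsRing))].
      apply (filterlim_continuous_punctured (fun t => t ^ j / INR (fact (S j)))); [|reflexivity].
      apply ex_derive_continuous_R. auto_derive; trivial.
    + apply (filterlim_continuous_punctured (fun t => - (harmonic (S j) * (t ^ S j / INR (fact (S j)))))).
      * apply ex_derive_continuous_R. auto_derive; trivial.
      * rewrite pow_i by lia. unfold Rdiv. ring.
Qed.

(** * Closed form of the iterated integrals *)

Lemma is_derive_sum_n_m (f : nat -> R -> R) (df : nat -> R) (n m : nat) (x : R) :
  (forall i, (n <= i <= m)%nat -> is_derive (f i) x (df i)) ->
  is_derive (fun y => sum_n_m (fun i => f i y) n m) x (sum_n_m df n m).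
Proof.
  induction m as [|m IH]; intros H.
  - destruct n as [|n].
    + rewrite sum_n_n. apply (is_derive_ext (f 0%nat)); [intros; now rewrite sum_n_n | apply H; lia].
    + rewrite sum_n_m_zero by lia.
      apply (is_derive_ext (fun _ => zero)); [intros; now rewrite sum_n_m_zero by lia|].
      apply (is_derive_const (V := R_NormedModule)).
  - destruct (le_lt_dec n (S m)) as [Hn|Hn].
    + rewrite sum_n_Sm by assumption.
      apply (is_derive_ext (fun y => plus (sum_n_m (fun i => f i y) n m) (f (S m) y)));
        [intros; now rewrite sum_n_Sm|].
      apply (is_derive_plus (K := R_AbsRing) (V := R_NormedModule));
        [apply IH; intros; apply H; lia | apply H; lia].
    + rewrite sum_n_m_zero by lia.
      apply (is_derive_ext (fun _ => zero)); [intros; now rewrite sum_n_m_zero by lia|].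
      apply (is_derive_const (V := R_NormedModule)).
Qed.

Lemma sum_n_m_eq_0 (a : nat -> R) (n m : nat) :
  (forall i, (n <= i <= m)%nat -> a i = 0) -> sum_n_m a n m = 0.
Proof.
  intros H. rewrite (sum_n_m_ext_loc a (fun _ => 0)) by assumption.
  apply (sum_n_m_const_zero (G := R_AbelianGroup)).
Qed.

Lemma sum_n_m_single (a : nat -> R) (n m q : nat) : (n <= q <= m)%nat ->
  (forall i, (n <= i <= m)%nat -> i <> q -> a i = 0) -> sum_n_m a n m = a q.
Proof.
  intros Hq H. rewrite (sum_n_m_Chasles a n q m) by lia.
  rewrite (sum_n_m_eq_0 a (S q) m) by (intros; apply H; lia).
  change plus with Rplus. rewrite Rplus_0_r.
  destruct q as [|q].
  - replace n with 0%nat by lia. now rewrite sum_n_n.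
  - rewrite sum_n_Sm by lia. rewrite (sum_n_m_eq_0 a n q) by (intros; apply H; lia).
    apply Rplus_0_l.
Qed.

(** The integration constant that the Clausen function of index 2i + 1 brings in. *)
Definition clausen_coef (i : nat) : R := (-1) ^ (i + 1) * zeta (2 * i + 1) / (2 * PI) ^ (2 * i).

(** The j-fold iterated integral from 0 of - ln (2 |sin (PI t)|), for j <= 2 I + 1:
    the polynomial part collects the values of the Clausen functions at 0. *)
Definition clausen_part (I j : nat) (t : R) : R :=
  match j with
  | O => - ln (2 * Rabs (sin (PI * t)))
  | S _ => sum_n_m (fun i => clausen_coef i * dpow (2 * i) j t) 1 I
           + (-1) ^ (j / 2) / (2 * PI) ^ j * Clausen (j + 1) (2 * PI * t)
  end.

Lemma half_even (q : nat) : (2 * q / 2 = q)%nat.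
Proof. rewrite Nat.mul_comm. now apply Nat.div_mul. Qed.

Lemma half_odd (q : nat) : ((2 * q + 1) / 2 = q)%nat.
Proof. rewrite Nat.add_comm, Nat.mul_comm, Nat.div_add by lia. reflexivity. Qed.

Lemma half_parity (j : nat) : exists q, j = (2 * q)%nat /\ (j / 2 = q)%nat /\ Nat.even j = true \/
  j = (2 * q + 1)%nat /\ (j / 2 = q)%nat /\ Nat.even j = false.
Proof.
  destruct (Nat.Even_or_Odd j) as [[q Hq]|[q Hq]]; exists q; [left|right]; subst j.
  - rewrite half_even, Nat.even_mul. auto.
  - rewrite half_odd, Nat.add_1_r, Nat.even_succ, Nat.odd_mul. auto.
Qed.

Lemma clausen_sign_step (j : nat) :
  (-1) ^ (S j / 2) * clausen_sign (S (S j)) = (-1) ^ (j / 2).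
Proof.
  unfold clausen_sign. simpl Nat.even.
  destruct (half_parity j) as [q [(Hj & Hq & He)|(Hj & Hq & He)]]; rewrite Hq, He.
  - replace (S j) with (2 * q + 1)%nat by lia. rewrite half_odd. ring.
  - replace (S j) with (2 * (q + 1))%nat by lia. rewrite half_even, pow_add. ring.
Qed.

Lemma is_derive_clausen_sum (I j : nat) (t : R) :
  is_derive (fun t => sum_n_m (fun i => clausen_coef i * dpow (2 * i) (S j) t) 1 I) t
    (sum_n_m (fun i => clausen_coef i * dpow (2 * i) j t) 1 I).
Proof.
  apply is_derive_sum_n_m. intros i _.
  apply (is_derive_scal (dpow (2 * i) (S j))), is_derive_dpow.
Qed.

Lemma is_derive_clausen_part (I j : nat) (t : R) : 0 < Rabs t < 1 ->
  is_derive (clausen_part I (S j)) t (clausen_part I j t).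
Proof.
  intros Ht. pose proof PI_RGT_0 as Hpi.
  assert (HC : forall n l, is_derive (Clausen n) (2 * PI * t) l ->
            forall c, is_derive (fun t => c * Clausen n (2 * PI * t)) t (c * (2 * PI * l))).
  { intros n l Hl c. apply (is_derive_scal (fun t => Clausen n (2 * PI * t))).
    apply (is_derive_comp (K := R_AbsRing) (V := R_NormedModule) (Clausen n) (fun t => 2 * PI * t) t l (2 * PI));
      [exact Hl|]. auto_derive; trivial. ring. }
  replace (clausen_part I j t) with
    (sum_n_m (fun i => clausen_coef i * dpow (2 * i) j t) 1 I
     + (-1) ^ (S j / 2) / (2 * PI) ^ (S j) *
       (2 * PI * match j with O => - ln (2 * Rabs (sin (2 * PI * t / 2)))
                 | S _ => clausen_sign (S (S j)) * Clausen (j + 1) (2 * PI * t) end)).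
  - apply (is_derive_plus (K := R_AbsRing) (V := R_NormedModule)
      (fun t => sum_n_m (fun i => clausen_coef i * dpow (2 * i) (S j) t) 1 I)
      (fun t => (-1) ^ (S j / 2) / (2 * PI) ^ (S j) * Clausen (S j + 1) (2 * PI * t)));
      [apply is_derive_clausen_sum|].
    apply HC. destruct j as [|j].
    + apply is_derive_Clausen_2. rewrite Rabs_mult, (Rabs_pos_eq (2 * PI)) by lra. split; nra.
    + replace (S (S j) + 1)%nat with (S (S (S j))) by lia.
      replace (S j + 1)%nat with (S (S j)) by lia. apply is_derive_Clausen. lia.
  - destruct j as [|j].
    + rewrite sum_n_m_eq_0.
      * simpl clausen_part. change (1 / 2)%nat with 0%nat.
        replace (2 * PI * t / 2) with (PI * t) by field. simpl. field. lra.
      * intros i Hi. unfold dpow. destruct (Nat.leb_spec (2 * i) 0); [lia|ring].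
    + unfold clausen_part. f_equal.
      rewrite <- (clausen_sign_step (S j)).
      pose proof (pow_lt (2 * PI) (S j) ltac:(lra)). 
      change ((2 * PI) ^ S (S j)) with (2 * PI * (2 * PI) ^ (S j)). field. lra.
Qed.

Lemma clausen_part_continuous_0 (I j : nat) : continuous (clausen_part I (S j)) 0.
Proof.
  apply (continuous_plus (K := R_AbsRing) (V := R_NormedModule)
      (fun t => sum_n_m (fun i => clausen_coef i * dpow (2 * i) (S j) t) 1 I)
      (fun t => (-1) ^ (S j / 2) / (2 * PI) ^ (S j) * Clausen (S j + 1) (2 * PI * t))).
  - apply ex_derive_continuous_R. eexists. apply is_derive_clausen_sum.
  - apply (continuous_mult (K := R_AbsRing) (fun _ => _) (fun t => Clausen (S j + 1) (2 * PI * t)));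
      [apply continuous_const|].
    apply (continuous_comp (fun t => 2 * PI * t) (Clausen (S j + 1))).
    + apply ex_derive_continuous_R. auto_derive; trivial.
    + apply Clausen_continuous. lia.
Qed.

(** For even j the Clausen function takes the value zeta(j + 1) at 0, and the
    summand i = j / 2 of the polynomial part cancels it; this summand is present
    because j <= 2 I + 1. *)
Lemma clausen_part_0 (I j : nat) : (S j <= 2 * I + 1)%nat -> clausen_part I (S j) 0 = 0.
Proof.
  intros HI. pose proof PI_RGT_0 as Hpi. unfold clausen_part. rewrite Rmult_0_r.
  destruct (half_parity (S j)) as [q [(Hj & Hq & He)|(Hj & Hq & He)]].
  - rewrite (sum_n_m_single _ 1 I q) by
      (lia || (intros i _ Hi; rewrite dpow_at_0 by lia; ring)).
    rewrite Clausen_odd_0 by (rewrite Nat.add_1_r, Nat.even_succ, <- Nat.negb_even, He; reflexivity).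
    rewrite Hq, Hj, dpow_diag. unfold clausen_coef. rewrite pow_add.
    pose proof (pow_lt (2 * PI) (2 * q) ltac:(lra)). field. lra.
  - rewrite Clausen_even_0 by (rewrite Nat.add_1_r, Nat.even_succ, <- Nat.negb_even, He; reflexivity).
    rewrite sum_n_m_eq_0 by (intros i Hi; rewrite dpow_at_0 by lia; ring).
    change (0 + (-1) ^ (S j / 2) / (2 * PI) ^ S j * 0 = 0). ring.
Qed.

(** The iterated integrals of log |Gamma| from 0, in closed form. *)
Definition logGamma_integral (I j : nat) (t : R) : R :=
  - euler_mascheroni * dpow 0 (S j) t + ln (2 * PI) / 2 * dpow 0 j t
  - / 2 * log_part j t + / 2 * clausen_part I j t - odd_zeta_series j t.

(** This is [logGamma_expansion], with log (sin (pi t) / (pi t)) expanded. *)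
Lemma logGamma_integral_0 (I : nat) (t : R) : 0 < Rabs t < 1 ->
  logGamma_integral I 0 t = logGamma t.
Proof.
  intros Ht. pose proof PI_RGT_0 as Hpi.
  rewrite (logGamma_expansion t Ht). unfold logGamma_integral, log_part, clausen_part, dpow. simpl.
  rewrite harmonic_0.
  pose proof (sin_PI_ratio_pos t Ht) as Hr.
  assert (Hs : sin (PI * t) <> 0).
  { intros E. rewrite E in Hr. unfold Rdiv in Hr. rewrite Rmult_0_l in Hr. lra. }
  assert (Ht0 : t <> 0) by (intros ->; rewrite Rabs_R0 in Ht; lra).
  pose proof (Rabs_pos_lt _ Hs).
  rewrite <- (Rabs_pos_eq (sin (PI * t) / (PI * t))) by lra.
  replace (Rabs (sin (PI * t) / (PI * t))) with (Rabs (sin (PI * t)) / (PI * Rabs t))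
    by (unfold Rdiv; rewrite Rabs_mult, Rabs_inv, Rabs_mult, (Rabs_pos_eq PI) by lra; reflexivity).
  assert (0 < PI * Rabs t) by (apply Rmult_lt_0_compat; lra).
  rewrite ln_div, (ln_mult PI (Rabs t)), (ln_mult 2 PI), (ln_mult 2) by lra.
  field.
Qed.

Lemma is_derive_logGamma_integral (I j : nat) (t : R) : 0 < Rabs t < 1 ->
  is_derive (logGamma_integral I (S j)) t (logGamma_integral I j t).
Proof.
  intros Ht.
  assert (Ht0 : t <> 0) by (intros ->; rewrite Rabs_R0 in Ht; lra).
  unfold logGamma_integral.
  apply (is_derive_minus (K := R_AbsRing) (V := R_NormedModule)
           (fun t => - euler_mascheroni * dpow 0 (S (S j)) t + ln (2 * PI) / 2 * dpow 0 (S j) t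
                     - / 2 * log_part (S j) t + / 2 * clausen_part I (S j) t)
           (odd_zeta_series (S j))); [|apply is_derive_odd_zeta; lra].
  apply (is_derive_plus (K := R_AbsRing) (V := R_NormedModule)
           (fun t => - euler_mascheroni * dpow 0 (S (S j)) t + ln (2 * PI) / 2 * dpow 0 (S j) t
                     - / 2 * log_part (S j) t) (fun t => / 2 * clausen_part I (S j) t));
    [|now apply (is_derive_scal (clausen_part I (S j))), is_derive_clausen_part].
  apply (is_derive_minus (K := R_AbsRing) (V := R_NormedModule)
           (fun t => - euler_mascheroni * dpow 0 (S (S j)) t + ln (2 * PI) / 2 * dpow 0 (S j) t)
           (fun t => / 2 * log_part (S j) t));
    [|now apply (is_derive_scal (log_part (S j))), is_derive_log_part].
  apply (is_derive_plus (K := R_AbsRing) (V := R_NormedModule)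
           (fun t => - euler_mascheroni * dpow 0 (S (S j)) t)
           (fun t => ln (2 * PI) / 2 * dpow 0 (S j) t));
    apply (is_derive_scal (dpow _ _)), is_derive_dpow.
Qed.

Lemma logGamma_integral_0_continuous (I : nat) (t : R) : 0 < Rabs t < 1 ->
  continuous (logGamma_integral I 0) t.
Proof.
  intros Ht.
  assert (Ht0 : t <> 0) by (intros ->; rewrite Rabs_R0 in Ht; lra).
  pose proof (sin_PI_ratio_pos t Ht) as Hr.
  assert (Hs : sin (PI * t) <> 0).
  { intros E. rewrite E in Hr. unfold Rdiv in Hr. rewrite Rmult_0_l in Hr. lra. }
  apply (continuous_minus (K := R_AbsRing) (V := R_NormedModule)
    (fun t => - euler_mascheroni * dpow 0 1 t + ln (2 * PI) / 2 * dpow 0 0 t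
              - / 2 * log_part 0 t + / 2 * clausen_part I 0 t) (odd_zeta_series 0));
    [|apply odd_zeta_continuous; lra].
  apply ex_derive_continuous_R.
  unfold log_part, clausen_part, dpow. simpl.
  pose proof (Rabs_pos_lt _ Hs). pose proof (Rabs_pos_lt _ Ht0).
  auto_derive. repeat split; trivial; lra.
Qed.

Lemma logGamma_integral_lim_0 (I j : nat) : (S j <= 2 * I + 1)%nat ->
  filterlim (logGamma_integral I (S j)) (locally' 0) (locally 0).
Proof.
  intros HI.
  (* The part that is continuous at 0. *)
  set (reg := fun t => - euler_mascheroni * dpow 0 (S (S j)) t + ln (2 * PI) / 2 * dpow 0 (S j) t
                       + / 2 * clausen_part I (S j) t - odd_zeta_series (S j) t).
  apply (filterlim_ext (fun t => reg t + (- / 2) * log_part (S j) t)).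
  { intros t. unfold reg, logGamma_integral. ring. }
  replace 0 with (0 + - / 2 * 0) at 2 by ring.
  apply (filterlim_comp_2 (F := locally' 0) (G := locally 0) (H := locally (- / 2 * 0))
           reg (fun t => - / 2 * log_part (S j) t) Rplus);
    [| |apply (filterlim_plus (V := R_NormedModule))].
  - apply filterlim_continuous_punctured.
    + apply (continuous_minus (K := R_AbsRing) (V := R_NormedModule)
        (fun t => - euler_mascheroni * dpow 0 (S (S j)) t + ln (2 * PI) / 2 * dpow 0 (S j) t
                       + / 2 * clausen_part I (S j) t) (odd_zeta_series (S j)));
        [|apply odd_zeta_continuous; rewrite Rabs_R0; lra].
      apply (continuous_plus (K := R_AbsRing) (V := R_NormedModule)
        (fun t => - euler_mascheroni * dpow 0 (S (S j)) t + ln (2 * PI) / 2 * dpow 0 (S j) t)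
        (fun t => / 2 * clausen_part I (S j) t)).
      * apply ex_derive_continuous_R. unfold dpow. simpl. auto_derive; trivial.
      * apply (continuous_mult (K := R_AbsRing) (fun _ => / 2) (clausen_part I (S j)));
          [apply continuous_const | apply clausen_part_continuous_0].
    + unfold reg. rewrite clausen_part_0, odd_zeta_series_0, !dpow_at_0 by lia. ring.
  - eapply filterlim_comp; [apply log_part_lim_0|].
    apply (filterlim_scal_r (K := R_AbsRing) (V := R_NormedModule) (- / 2) 0).
Qed.

Lemma negapolygamma_closed_form (I j : nat) (z : R) : 0 < Rabs z < 1 ->
  (S j <= 2 * I + 1)%nat -> negapolygamma (j + 2) z = logGamma_integral I (S j) z.
Proof.
  intros Hz HI. apply (negapolygamma_chain (logGamma_integral I)); trivial.
  - intros; now apply is_derive_logGamma_integral.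
  - intros i Hi. apply logGamma_integral_lim_0. lia.
  - intros; now apply logGamma_integral_0_continuous.
  - intros; now apply logGamma_integral_0.
Qed.

(** * The weight functional *)

Lemma sum_n_m_scal (c : R) (a : nat -> R) (n m : nat) :
  sum_n_m (fun k => c * a k) n m = c * sum_n_m a n m.
Proof. exact (sum_n_m_mult_l (K := R_Ring) c a n m). Qed.

(** Repeated integration by parts of t ^ p times the member of index M of a chain u
    of antiderivatives produces this sum, up to powers of t. *)
Definition falling_altsum (u : nat -> R) (p M : nat) : R :=
  sum_n (fun k => (-1) ^ k * (INR (fact p) / INR (fact (p - k))) * u (M + 1 + k)%nat) p.

Lemma falling_altsum_0 (u : nat -> R) (M : nat) : falling_altsum u 0 M = u (M + 1)%nat.
Proof. unfold falling_altsum. rewrite sum_O, Nat.add_0_r. simpl. eq_real. field. Qed.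

(** Splitting off the first term yields a recurrence which lowers p and raises M;
    it is the only property of the sum that the evaluations below use. *)
Lemma falling_altsum_S (u : nat -> R) (p M : nat) :
  falling_altsum u (S p) M = u (M + 1)%nat - INR (S p) * falling_altsum u p (M + 1).
Proof.
  unfold falling_altsum, sum_n. rewrite sum_Sn_m by lia. rewrite <- sum_n_m_S.
  set (G := fun k => (-1) ^ k * (INR (fact p) / INR (fact (p - k))) * u (M + 1 + 1 + k)%nat).
  assert (E : sum_n_m (fun k => (-1) ^ S k * (INR (fact (S p)) / INR (fact (S p - S k)))
                                * u (M + 1 + S k)%nat) 0 p = - INR (S p) * sum_n_m G 0 p).
  { rewrite <- sum_n_m_scal.
    apply sum_n_m_ext. intros k. unfold G.
    rewrite Nat.sub_succ, (fact_simpl p), mult_INR.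
    replace (M + 1 + S k)%nat with (M + 1 + 1 + k)%nat by lia.
    change ((-1) ^ S k) with (-1 * (-1) ^ k). unfold Rdiv. eq_real. ring. }
  rewrite E. change plus with Rplus.
  rewrite Nat.add_0_r, Nat.sub_0_r. pose proof (INR_fact_pos (S p)). rewrite pow_O. field. lra.
Qed.

Lemma falling_altsum_ext (u v : nat -> R) (p M : nat) :
  (forall k, (k <= p)%nat -> u (M + 1 + k)%nat = v (M + 1 + k)%nat) ->
  falling_altsum u p M = falling_altsum v p M.
Proof. intros H. apply sum_n_ext_loc. intros k Hk. now rewrite H. Qed.

Lemma falling_altsum_shift (u : nat -> R) (N p M : nat) :
  falling_altsum (fun j => u (N + j)%nat) p M = falling_altsum u p (N + M).
Proof.
  apply sum_n_ext. intros k. now replace (N + (M + 1 + k))%nat with (N + M + 1 + k)%nat by lia.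
Qed.

(** 1 / (j - s)!, read as 0 when j < s. *)
Definition rfact (s j : nat) : R := if (s <=? j)%nat then / INR (fact (j - s)) else 0.

(** When j + 1 <= s both sides vanish. *)
Lemma rfact_S (s j : nat) : (INR j + 1 - INR s) * rfact s (j + 1) = rfact s j.
Proof.
  unfold rfact. destruct (Nat.leb_spec s (j + 1)) as [H|H].
  - destruct (Nat.leb_spec s j) as [H'|H'].
    + replace (j + 1 - s)%nat with (S (j - s)) by lia.
      rewrite fact_simpl, mult_INR, S_INR, minus_INR by assumption.
      pose proof (INR_fact_pos (j - s)). pose proof (le_INR _ _ H'). field. lra.
    + replace s with (j + 1)%nat by lia. rewrite plus_INR. simpl (INR 1). ring.
  - destruct (Nat.leb_spec s j) as [H'|H']; [lia|ring].
Qed.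

(** The factor on the left may be zero; it is kept there so that the induction
    does not need to avoid this case. *)
Lemma falling_altsum_rfact (s p M : nat) :
  (INR (M + p + 1) - INR s) * falling_altsum (rfact s) p M = rfact s M.
Proof.
  revert M. induction p as [|p IH]; intros M.
  - rewrite falling_altsum_0, <- (rfact_S s M), !plus_INR. simpl. ring.
  - rewrite falling_altsum_S. specialize (IH (M + 1)%nat).
    replace (M + S p + 1)%nat with (M + 1 + p + 1)%nat by lia.
    set (A := falling_altsum (rfact s) p (M + 1)) in *.
    transitivity ((INR (M + 1 + p + 1) - INR s) * rfact s (M + 1)
                  - INR (S p) * ((INR (M + 1 + p + 1) - INR s) * A)); [ring|].
    rewrite IH.
    rewrite <- (rfact_S s M), !plus_INR, (S_INR p). simpl (INR 1). ring.
Qed.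

(** The case in which the factor of [falling_altsum_rfact] is zero. *)
Lemma falling_altsum_rfact_critical (p M : nat) :
  falling_altsum (rfact (M + p + 1)) p M = (-1) ^ p * INR (fact p).
Proof.
  revert M. induction p as [|p IH]; intros M.
  - rewrite falling_altsum_0. unfold rfact. rewrite Nat.add_0_r, Nat.leb_refl, Nat.sub_diag.
    simpl. field.
  - rewrite falling_altsum_S. replace (M + S p + 1)%nat with (M + 1 + p + 1)%nat by lia.
    rewrite IH. unfold rfact. destruct (Nat.leb_spec (M + 1 + p + 1) (M + 1)); [lia|].
    rewrite fact_simpl, mult_INR. simpl pow. ring.
Qed.

(** The formal derivative in s, at s = 0, of [falling_altsum_rfact]: differentiating
    1 / (j - s)! gives H_j / j! up to the Euler constant. *)
Lemma falling_altsum_harmonic (p M : nat) :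
  falling_altsum (fun j => harmonic j * rfact 0 j) p M
  = rfact 0 M * (harmonic M + / INR (M + p + 1)) / INR (M + p + 1).
Proof.
  assert (Hpos : forall a, 0 < INR (a + 1)) by (intros a; apply lt_0_INR; lia).
  assert (HS : forall N, harmonic (N + 1) * rfact 0 (N + 1)
           = rfact 0 N * (harmonic N + / INR (N + 1)) / INR (N + 1)).
  { intros N. rewrite <- (rfact_S 0 N). pose proof (Hpos N) as H.
    replace (INR N + 1 - INR 0) with (INR (N + 1)) by (rewrite plus_INR; simpl; ring).
    replace (harmonic (N + 1)) with (harmonic N + / INR (N + 1))
      by (rewrite Nat.add_1_r; symmetry; apply harmonic_S).
    field. lra. }
  revert M. induction p as [|p IH]; intros M.
  - rewrite falling_altsum_0, HS, Nat.add_0_r. reflexivity.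
  - rewrite falling_altsum_S, IH, HS, <- (rfact_S 0 M).
    replace (M + 1 + p + 1)%nat with (M + S p + 1)%nat by lia.
    replace (harmonic (M + 1)) with (harmonic M + / INR (M + 1))
      by (rewrite Nat.add_1_r; symmetry; apply harmonic_S).
    replace (INR M + 1 - INR 0) with (INR (M + 1)) by (rewrite plus_INR; simpl; ring).
    pose proof (Hpos M) as H1. pose proof (Hpos (M + S p)%nat) as H2.
    assert (E : INR (S p) = INR (M + S p + 1) - INR (M + 1)) by (rewrite !plus_INR; ring).
    rewrite E. field. lra.
Qed.

(** The linear functional which sends v_j = N! / (N + j)! to
    N * N! / ((N + m + 1)! (N + m + p + 2)), the weight of the series. *)
Definition weight (p m : nat) (v : nat -> R) : R :=
  v (m + 1)%nat - INR (p + m + 2) * falling_altsum v p (m + 1).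

Lemma weight_ext (p m : nat) (v w : nat -> R) :
  (forall j, (m + 1 <= j <= p + m + 2)%nat -> v j = w j) -> weight p m v = weight p m w.
Proof.
  intros H. unfold weight. rewrite (H (m + 1)%nat) by lia.
  now rewrite (falling_altsum_ext v w) by (intros k Hk; apply H; lia).
Qed.

Lemma weight_plus (p m : nat) (v w : nat -> R) :
  weight p m (fun j => v j + w j) = weight p m v + weight p m w.
Proof.
  unfold weight.
  assert (E : falling_altsum (fun j => v j + w j) p (m + 1)
              = falling_altsum v p (m + 1) + falling_altsum w p (m + 1)).
  { unfold falling_altsum. rewrite <- (sum_n_plus (G := R_AbelianGroup)).
    apply sum_n_ext. intros k. change plus with Rplus. eq_real. ring. }
  rewrite E. ring.
Qed.

Lemma weight_scal (p m : nat) (c : R) (v : nat -> R) :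
  weight p m (fun j => c * v j) = c * weight p m v.
Proof.
  unfold weight.
  assert (E : falling_altsum (fun j => c * v j) p (m + 1) = c * falling_altsum v p (m + 1)).
  { unfold falling_altsum, sum_n. rewrite <- sum_n_m_scal.
    apply sum_n_m_ext. intros k. eq_real. ring. }
  rewrite E. ring.
Qed.

Lemma weight_sum (p m a b : nat) (v : nat -> nat -> R) :
  weight p m (fun j => sum_n_m (fun i => v i j) a b) = sum_n_m (fun i => weight p m (v i)) a b.
Proof.
  assert (Hz : weight p m (fun _ => 0) = 0).
  { rewrite (weight_ext p m _ (fun j => 0 * 0)) by (intros; ring).
    rewrite (weight_scal p m 0 (fun _ => 0)). ring. }
  induction b as [|b IH].
  - destruct a as [|a].
    + rewrite sum_n_n. apply weight_ext. intros j _. now rewrite sum_n_n.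
    + rewrite (sum_n_m_zero _ _ _ (Nat.lt_0_succ a)). transitivity (weight p m (fun _ => 0)); [|exact Hz].
      apply weight_ext. intros j _. now rewrite sum_n_m_zero by lia.
  - destruct (le_lt_dec a (S b)) as [H|H].
    + rewrite sum_n_Sm by assumption. rewrite <- IH. change plus with Rplus.
      rewrite <- weight_plus. apply weight_ext. intros j _. now rewrite sum_n_Sm.
    + rewrite (sum_n_m_zero _ _ _ H). transitivity (weight p m (fun _ => 0)); [|exact Hz].
      apply weight_ext. intros j _. now rewrite sum_n_m_zero by lia.
Qed.

Lemma is_series_sum_n (a : nat -> nat -> R) (l : nat -> R) (q : nat) :
  (forall k, is_series (a k) (l k)) ->
  is_series (fun n => sum_n (fun k => a k n) q) (sum_n l q).
Proof.
  intros H. induction q as [|q IH].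
  - rewrite sum_O. apply (is_series_ext (a 0%nat)); [intros n; now rewrite sum_O | apply H].
  - rewrite sum_Sn.
    apply (is_series_ext (fun n => plus (sum_n (fun k => a k n) q) (a (S q) n)));
      [intros n; now rewrite sum_Sn|].
    apply (is_series_plus (V := R_NormedModule)); [apply IH | apply H].
Qed.

Lemma weight_series (p m : nat) (a : nat -> nat -> R) (l : nat -> R) :
  (forall j, is_series (a j) (l j)) ->
  is_series (fun n => weight p m (fun j => a j n)) (weight p m l).
Proof.
  intros H. unfold weight.
  apply (is_series_minus (V := R_NormedModule)); [apply H|].
  apply (is_series_scal (V := R_NormedModule)).
  apply is_series_sum_n. intros k.
  apply (is_series_scal (V := R_NormedModule)), H.
Qed.

(** With N = - s, the sequence is 1 / (N + j)! and the value is
    N / ((N+m+1)! (N+m+p+2)). *)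
Lemma weight_rfact (p m s : nat) : s <> (p + m + 2)%nat ->
  weight p m (rfact s) = - INR s * rfact s (m + 1) / (INR (p + m + 2) - INR s).
Proof.
  intros Hs. unfold weight. pose proof (falling_altsum_rfact s p (m + 1)) as H.
  replace (m + 1 + p + 1)%nat with (p + m + 2)%nat in H by lia.
  assert (INR (p + m + 2) - INR s <> 0) by (apply Rminus_eq_contra, not_INR; auto).
  rewrite <- H. field. assumption.
Qed.

Lemma weight_rfact_critical (p m : nat) :
  weight p m (rfact (p + m + 2)) = - INR (p + m + 2) * (-1) ^ p * INR (fact p).
Proof.
  unfold weight. pose proof (falling_altsum_rfact_critical p (m + 1)) as H.
  replace (m + 1 + p + 1)%nat with (p + m + 2)%nat in H by lia.
  rewrite H. unfold rfact. destruct (Nat.leb_spec (p + m + 2) (m + 1)); [lia|]. ring.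
Qed.

Lemma weight_rfact_shift (p m N : nat) :
  weight p m (fun j => rfact 0 (N + j)) = INR N * rfact 0 (N + m + 1) / INR (N + m + p + 2).
Proof.
  unfold weight. rewrite falling_altsum_shift.
  pose proof (falling_altsum_rfact 0 p (N + (m + 1))) as H.
  replace (N + (m + 1) + p + 1)%nat with (N + m + p + 2)%nat in H by lia.
  replace (N + (m + 1))%nat with (N + m + 1)%nat in * by lia.
  assert (0 < INR (N + m + p + 2)) by (apply lt_0_INR; lia).
  rewrite <- H.
  replace (INR (p + m + 2)) with (INR (N + m + p + 2) - INR N) by (rewrite !plus_INR; ring).
  simpl (INR 0). field. lra.
Qed.

Lemma weight_harmonic (p m : nat) :
  weight p m (fun j => harmonic j * rfact 0 j) = - / (INR (fact (m + 1)) * INR (p + m + 2)).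
Proof.
  unfold weight. rewrite falling_altsum_harmonic.
  replace (m + 1 + p + 1)%nat with (p + m + 2)%nat by lia.
  unfold rfact. simpl Nat.leb. cbv iota. rewrite Nat.sub_0_r.
  assert (0 < INR (p + m + 2)) by (apply lt_0_INR; lia).
  pose proof (INR_fact_pos (m + 1)). field. lra.
Qed.

Lemma dpow_div (s j : nat) (z : R) : z <> 0 -> dpow s j z / z ^ (j + 1) = / z ^ (s + 1) * rfact s j.
Proof.
  intros Hz. unfold dpow, rfact. destruct (Nat.leb_spec s j) as [H|H]; [|unfold Rdiv; ring].
  replace (j + 1)%nat with ((j - s) + (s + 1))%nat by lia. rewrite (pow_add z (j - s)).
  pose proof (pow_nonzero z (j - s) Hz). pose proof (pow_nonzero z (s + 1) Hz).
  pose proof (INR_fact_pos (j - s)). field. repeat split; try assumption; lra.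
Qed.

Lemma prod_consecutive (N m : nat) :
  prod_f_R0 (fun i => INR (N + 1 + i)) m = INR (fact (N + m + 1)) / INR (fact N).
Proof.
  pose proof (INR_fact_pos N).
  induction m as [|m IH]; simpl prod_f_R0.
  - rewrite !Nat.add_0_r. replace (fact (N + 1)) with ((N + 1) * fact N)%nat
      by (rewrite Nat.add_1_r; reflexivity).
    rewrite mult_INR. field. lra.
  - rewrite IH. replace (N + S m + 1)%nat with (S (N + m + 1)) by lia.
    rewrite fact_simpl, mult_INR. replace (S (N + m + 1)) with (N + 1 + S m)%nat by lia.
    field. lra.
Qed.

(** With N = 2n + 3, the denominator is (N+m+1)! / N! times N + m + p + 2. *)
Lemma weight_odd_zeta_term (p m n : nat) (z : R) : z <> 0 ->
  weight p m (fun j => odd_zeta_term j n z / z ^ (j + 1))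
  = zeta (2 * S n + 1) * z ^ (2 * S n) / zeta_series_den p m (S n).
Proof.
  intros Hz.
  rewrite (weight_ext p m _ (fun j => zeta (2 * n + 3) * INR (fact (2 * n + 2)) * z ^ (2 * n + 2)
                                      * rfact 0 (2 * n + 3 + j))).
  2:{ intros j _. unfold odd_zeta_term, rfact. simpl Nat.leb. cbv iota. rewrite Nat.sub_0_r.
      replace (2 * n + 3 + j)%nat with (2 * n + 2 + (j + 1))%nat at 2 by lia. rewrite pow_add.
      pose proof (pow_nonzero z (j + 1) Hz). pose proof (INR_fact_pos (2 * n + 3 + j)).
      field. split; [lra | assumption]. }
  rewrite weight_scal, weight_rfact_shift.
  unfold zeta_series_den.
  replace (2 * S n + m + p + 3)%nat with (2 * n + 3 + m + p + 2)%nat by lia.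
  replace (2 * S n + 2)%nat with (2 * n + 3 + 1)%nat by lia.
  rewrite prod_consecutive.
  replace (2 * S n + 1)%nat with (2 * n + 3)%nat by lia.
  replace (2 * S n)%nat with (2 * n + 2)%nat by lia.
  unfold rfact. simpl Nat.leb. cbv iota. rewrite Nat.sub_0_r.
  replace (fact (2 * n + 3)) with ((2 * n + 3) * fact (2 * n + 2))%nat
    by (replace (2 * n + 3)%nat with (S (2 * n + 2)) by lia; reflexivity).
  rewrite mult_INR.
  pose proof (INR_fact_pos (2 * n + 2)). pose proof (INR_fact_pos (2 * n + 3 + m + 1)).
  assert (0 < INR (2 * n + 3 + m + p + 2)) by (apply lt_0_INR; lia).
  assert (0 < INR (2 * n + 3)) by (apply lt_0_INR; lia).
  field. lra.
Qed.

(** * Assembling the theorem *)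

Lemma sum_n_m_shift (a : nat -> R) (s p : nat) :
  sum_n_m a s (p + s) = sum_n (fun k => a (s + k)%nat) p.
Proof.
  induction p as [|p IH].
  - rewrite sum_n_n, sum_O. now rewrite Nat.add_0_r.
  - simpl Nat.add at 1. rewrite sum_n_Sm by lia. rewrite IH, sum_Sn.
    now replace (s + S p)%nat with (S (p + s)) by lia.
Qed.

Lemma half_succ_sign (j : nat) : (-1) ^ (S j / 2) = (-1) ^ j * (-1) ^ (j / 2).
Proof.
  destruct (half_parity j) as [q [(Hj & Hq & _)|(Hj & Hq & _)]]; rewrite Hq.
  - replace (S j) with (2 * q + 1)%nat by lia. rewrite half_odd, Hj, pow_1_even. ring.
  - replace (S j) with (2 * (q + 1))%nat by lia. rewrite half_even, Hj, !pow_add, pow_1_even. ring.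
Qed.

(** The value at j = m + 1 is the isolated Clausen term of the theorem, and the
    alternating sum is its Clausen sum; the two floor functions are related by
    [half_succ_sign]. *)
Lemma weight_clausen (p m : nat) (th : R) : th <> 0 ->
  weight p m (fun j => (-1) ^ (j / 2) * PI * Clausen (j + 1) th / th ^ (j + 1))
  = (-1) ^ ((m + 1) / 2) * PI * Clausen (m + 2) th / th ^ (m + 2)
    + INR (p + m + 2) * ((-1) ^ (m + 1) * INR (fact p) *
          sum_n_m (fun k => PI * (-1) ^ (k / 2) * Clausen k th
              / (INR (fact (p + m + 3 - k)) * th ^ k)) (m + 3) (p + m + 3)).
Proof.
  intros Hth. unfold weight, falling_altsum.
  replace (m + 1 + 1)%nat with (m + 2)%nat by lia.
  replace (p + m + 3)%nat with (p + (m + 3))%nat by lia. rewrite sum_n_m_shift.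
  unfold sum_n at 2. rewrite <- sum_n_m_scal.
  unfold Rminus. f_equal. rewrite Ropp_mult_distr_r. f_equal.
  rewrite <- (Rmult_1_l (sum_n _ p)), Ropp_mult_distr_l. unfold sum_n. rewrite <- sum_n_m_scal.
  apply sum_n_m_ext_loc. intros k Hk. eq_real.
  replace (p + (m + 3) - (m + 3 + k))%nat with (p - k)%nat by lia.
  replace (m + 2 + k + 1)%nat with (m + 3 + k)%nat by lia.
  replace ((m + 3 + k) / 2)%nat with (S (m + 2 + k) / 2)%nat by (f_equal; lia).
  rewrite half_succ_sign, !pow_add.
  assert (Hm : (-1) ^ m * (-1) ^ m = 1) by (rewrite <- pow_add, <- (pow_1_even m); f_equal; lia).
  pose proof (INR_fact_pos (p - k)). pose proof (pow_nonzero th m Hth).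
  pose proof (pow_nonzero th k Hth). pose proof (pow_nonzero th 3 Hth).
  (* The two sides differ by the sign (-1) ^ (2m). *)
  match goal with |- ?a = ?b => replace b with (((-1) ^ m * (-1) ^ m) * a) end;
    [rewrite Hm; ring|].
  field. repeat split; try assumption; lra.
Qed.

Lemma weight_negapolygamma (p m : nat) (z : R) : z <> 0 ->
  weight p m (fun j => negapolygamma (j + 1) z / z ^ (j + 1))
  = negapolygamma (m + 2) z / z ^ (m + 2)
    - INR (p + m + 2) * sum_n_m (fun k => INR (fact p) * (-1) ^ k * negapolygamma (k + m + 3) z
              / (INR (fact (p - k)) * z ^ (k + m + 3))) 0 p.
Proof.
  intros Hz. unfold weight, falling_altsum, sum_n.
  replace (m + 1 + 1)%nat with (m + 2)%nat by lia.
  f_equal. f_equal. apply sum_n_m_ext. intros k. eq_real.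
  replace (m + 2 + k + 1)%nat with (k + m + 3)%nat by lia.
  pose proof (INR_fact_pos (p - k)). pose proof (pow_nonzero z (k + m + 3) Hz).
  field. split; [assumption | lra].
Qed.

(** For m + 1 < 2i < p + m + 2 the weight is 0 since 1 / (m+1-2i)! is; the last index
    i = (p + m + 2) / 2 is critical exactly when p + m is even. *)
Lemma weight_zeta_values (p m : nat) (z : R) : z <> 0 ->
  weight p m (fun j => sum_n_m (fun i => clausen_coef i / (2 * z ^ (2 * i + 1)) * rfact (2 * i) j)
                         1 ((p + m + 2) / 2))
  = sum_n_m (fun k => INR k * (-1) ^ k * zeta (2 * k + 1)
           / (z * (2 * PI * z) ^ (2 * k) * INR (fact (m + 1 - 2 * k)) * INR (m + p + 2 - 2 * k)))
         1 ((m + 1) / 2)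
    - INR (p + m + 2) *
      (if Nat.even (p + m) then
             INR (fact p) * (-1) ^ ((p + m) / 2) * (-1) ^ m * zeta (p + m + 3)
             / (2 * z * (2 * PI * z) ^ (m + p + 2))
           else 0).
Proof.
  intros Hz. pose proof PI_RGT_0 as Hpi.
  rewrite (weight_sum p m 1 _ (fun i j => clausen_coef i / (2 * z ^ (2 * i + 1)) * rfact (2 * i) j)).
  set (c := fun i => clausen_coef i / (2 * z ^ (2 * i + 1))).
  rewrite (sum_n_m_ext _ (fun i => c i * weight p m (rfact (2 * i))))
    by (intros i; apply weight_scal).
  assert (Hm : exists q, ((m + 1) / 2 = q)%nat /\ (2 * q <= m + 1 < 2 * q + 2)%nat).
  { destruct (half_parity (m + 1)) as [q [(Hj & Hq & _)|(Hj & Hq & _)]]; exists q; lia. }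
  destruct Hm as (q & -> & Hq).
  assert (HI : exists I, ((p + m + 2) / 2 = I)%nat /\
     (if Nat.even (p + m) then ((p + m) / 2 = I - 1 /\ 2 * I = p + m + 2)%nat
      else (2 * I = p + m + 1)%nat)).
  { destruct (half_parity (p + m)) as [r [(Hj & Hr & He)|(Hj & Hr & He)]];
      exists (r + 1)%nat; rewrite He.
    - replace (p + m + 2)%nat with (2 * (r + 1))%nat by lia. rewrite half_even. lia.
    - replace (p + m + 2)%nat with (2 * (r + 1) + 1)%nat by lia. rewrite half_odd. lia. }
  destruct HI as (I & -> & HI).
  assert (HqI : (q <= I)%nat) by (destruct (Nat.even (p + m)); lia).
  rewrite (sum_n_m_Chasles _ 1 q I) by lia. change plus with Rplus. unfold Rminus.
  f_equal.
  - apply sum_n_m_ext_loc. intros i Hi. eq_real.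
    rewrite weight_rfact by lia. unfold c, clausen_coef, rfact.
    destruct (Nat.leb_spec (2 * i) (m + 1)) as [Hle|]; [|lia].
    replace (INR (p + m + 2) - INR (2 * i)) with (INR (m + p + 2 - 2 * i))
      by (rewrite minus_INR by lia; do 2 f_equal; lia).
    assert (0 < INR (m + p + 2 - 2 * i)) by (apply lt_0_INR; lia).
    rewrite (mult_INR 2 i), !pow_add, !(Rpow_mult_distr _ z). simpl (INR 2).
    pose proof (INR_fact_pos (m + 1 - 2 * i)). pose proof (pow_nonzero z (2 * i) Hz).
    pose proof (pow_lt (2 * PI) (2 * i) ltac:(lra)).
    field. repeat split; try assumption; lra.
  - destruct (Nat.even (p + m)) eqn:He.
    + destruct HI as [HI1 HI2].
      rewrite (sum_n_m_single _ (S q) I I).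
      * rewrite HI2, weight_rfact_critical. unfold c, clausen_coef. rewrite HI2, HI1.
        replace (p + m + 2 + 1)%nat with (p + m + 3)%nat by lia.
        replace (m + p + 2)%nat with (p + m + 2)%nat by lia.
        replace (I + 1)%nat with (I - 1 + 2)%nat by lia.
        replace (z ^ (p + m + 3)) with (z * z ^ (p + m + 2))
          by (replace (p + m + 3)%nat with (S (p + m + 2)) by lia; reflexivity).
        rewrite !Rpow_mult_distr, (pow_add (-1) (I - 1) 2).
        assert (Hpm : (-1) ^ p = (-1) ^ m).
        { assert (E : (-1) ^ p * (-1) ^ m = 1).
          { rewrite <- pow_add. replace (p + m)%nat with (2 * (I - 1))%nat by lia. apply pow_1_even. }
          assert (E2 : (-1) ^ m * (-1) ^ m = 1)
            by (rewrite <- pow_add, <- (pow_1_even m); f_equal; lia).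
          rewrite <- (Rmult_1_r ((-1) ^ p)), <- E2, <- Rmult_assoc, E. ring. }
        rewrite Hpm.
        pose proof (pow_nonzero z (p + m + 2) Hz).
        pose proof (pow_lt 2 (p + m + 2) ltac:(lra)). pose proof (pow_lt PI (p + m + 2) ltac:(lra)).
        eq_real. field. repeat split; try assumption; lra.
      * lia.
      * intros i Hi Hne. rewrite weight_rfact by lia. unfold rfact.
        destruct (Nat.leb_spec (2 * i) (m + 1)); [lia|]. unfold Rdiv; ring.
    + rewrite sum_n_m_eq_0; [eq_real; ring|].
      intros i Hi. rewrite weight_rfact by lia. unfold rfact.
      destruct (Nat.leb_spec (2 * i) (m + 1)); [lia|]. unfold Rdiv; ring.
Qed.

(** The closed form of the negapolygamma, solved for the zeta series. *)
Lemma odd_zeta_series_closed_form (I j : nat) (z : R) : 0 < Rabs z < 1 ->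
  (1 <= j <= 2 * I + 1)%nat ->
  odd_zeta_series j z / z ^ (j + 1)
  = - euler_mascheroni * rfact 0 (1 + j)
    + (ln (2 * PI) - ln (Rabs z)) / (2 * z) * rfact 0 j
    + / (2 * z) * (harmonic j * rfact 0 j)
    + sum_n_m (fun i => clausen_coef i / (2 * z ^ (2 * i + 1)) * rfact (2 * i) j) 1 I
    + (-1) ^ (j / 2) * PI * Clausen (j + 1) (2 * PI * z) / (2 * PI * z) ^ (j + 1)
    + -1 * (negapolygamma (j + 1) z / z ^ (j + 1)).
Proof.
  intros Hz Hj. pose proof PI_RGT_0 as Hpi.
  assert (Hz0 : z <> 0) by (intros ->; rewrite Rabs_R0 in Hz; lra).
  destruct j as [|j]; [lia|].
  replace (S j + 1)%nat with (j + 2)%nat at 4 by lia.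
  rewrite (negapolygamma_closed_form I j z Hz) by lia.
  unfold logGamma_integral, log_part, clausen_part.
  pose proof (dpow_div 0 (S j) z Hz0) as E0.
  pose proof (dpow_div 0 (S (S j)) z Hz0) as E1.
  set (w := z ^ (S j + 1)) in *.
  assert (Hw : w <> 0) by now apply pow_nonzero.
  assert (E0' : dpow 0 (S j) z = w * / z * rfact 0 (S j)).
  { transitivity (dpow 0 (S j) z / w * w); [field; assumption|]. rewrite E0. simpl. field. assumption. }
  assert (E1' : dpow 0 (S (S j)) z = w * rfact 0 (1 + S j)).
  { replace (z ^ (S (S j) + 1)) with (z * w) in E1 by (unfold w; simpl; ring).
    transitivity (dpow 0 (S (S j)) z / (z * w) * (z * w)); [field; auto|].
    rewrite E1. simpl. field. assumption. }
  assert (ES : sum_n_m (fun i => clausen_coef i / (2 * z ^ (2 * i + 1)) * rfact (2 * i) (S j)) 1 I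
               = / (2 * w) * sum_n_m (fun i => clausen_coef i * dpow (2 * i) (S j) z) 1 I).
  { rewrite <- sum_n_m_scal. apply sum_n_m_ext. intros i. eq_real.
    pose proof (dpow_div (2 * i) (S j) z Hz0) as Ei. fold w in Ei.
    pose proof (pow_nonzero z (2 * i + 1) Hz0).
    transitivity (clausen_coef i / 2 * (/ z ^ (2 * i + 1) * rfact (2 * i) (S j)));
      [field; assumption|].
    rewrite <- Ei. field. assumption. }
  rewrite ES, E0', E1', (Rpow_mult_distr (2 * PI) z). fold w.
  set (Cl := Clausen (S j + 1) (2 * PI * z)).
  rewrite (pow_add (2 * PI) (S j) 1).
  pose proof (pow_lt (2 * PI) (S j) ltac:(lra)).
  field. repeat split; try assumption; lra.
Qed.

Theorem mainTheorem11 (p m : nat) (z : R) (hz : 0 < Rabs z < 1) :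
  is_series
    (fun j : nat => let n := S j in
       zeta (2 * n + 1) * z ^ (2 * n) / zeta_series_den p m n)
    (INR (p + m + 2) *
       ((-1) ^ (m + 1) * INR (fact p) *
          sum_n_m (fun k : nat =>
              PI * (-1) ^ (k / 2) * Clausen k (2 * PI * z)
              / (INR (fact (p + m + 3 - k)) * (2 * PI * z) ^ k))
            (m + 3) (p + m + 3)
        - (if Nat.even (p + m) then
             INR (fact p) * (-1) ^ ((p + m) / 2) * (-1) ^ m * zeta (p + m + 3)
             / (2 * z * (2 * PI * z) ^ (m + p + 2))
           else 0)
        + sum_n_m (fun k : nat =>
              INR (fact p) * (-1) ^ k * negapolygamma (k + m + 3) z
              / (INR (fact (p - k)) * z ^ (k + m + 3)))
            0 p)
     - euler_mascheroni / (INR (fact (m + 2)) * INR (p + m + 3))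
     - 1 / (2 * z * INR (fact (m + 1)) * INR (p + m + 2))
     + (-1) ^ ((m + 1) / 2) * Clausen (m + 2) (2 * PI * z)
       / (2 * z * (2 * PI * z) ^ (m + 1))
     - negapolygamma (m + 2) z / z ^ (m + 2)
     + sum_n_m (fun k : nat =>
           INR k * (-1) ^ k * zeta (2 * k + 1)
           / (z * (2 * PI * z) ^ (2 * k) * INR (fact (m + 1 - 2 * k))
              * INR (m + p + 2 - 2 * k)))
         1 ((m + 1) / 2)).
Proof.
  pose proof PI_RGT_0 as Hpi.
  assert (Hz0 : z <> 0) by (intros ->; rewrite Rabs_R0 in hz; lra).
  (* The closed form is needed for the indices j <= p + m + 2 of the functional. *)
  set (I := ((p + m + 2) / 2)%nat).
  assert (HI : (p + m + 2 <= 2 * I + 1)%nat).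
  { unfold I. destruct (half_parity (p + m + 2)) as [q [(Hj & Hq & _)|(Hj & Hq & _)]]; lia. }
  pose proof (weight_series p m (fun j n => / z ^ (j + 1) * odd_zeta_term j n z)
                (fun j => / z ^ (j + 1) * odd_zeta_series j z)) as HS.
  match type of HS with ?A -> _ => assert (H : A) end.
  { intros j. apply (is_series_scal (V := R_NormedModule)).
    apply Series_correct, ex_series_odd_zeta. lra. }
  specialize (HS H). clear H.
  match goal with |- is_series _ ?l => set (rhs := l) end.
  assert (Hrhs : weight p m (fun j => / z ^ (j + 1) * odd_zeta_series j z) = rhs).
  2:{ rewrite <- Hrhs. eapply is_series_ext; [|exact HS].
      intros n. cbv beta zeta. rewrite <- weight_odd_zeta_term by assumption.
      apply weight_ext. intros j _. apply Rmult_comm. }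
  set (th := 2 * PI * z).
  assert (Hth : th <> 0) by (unfold th; apply Rmult_integral_contrapositive_currified; lra).
  set (f1 := fun j => - euler_mascheroni * rfact 0 (1 + j)).
  set (f2 := fun j => (ln (2 * PI) - ln (Rabs z)) / (2 * z) * rfact 0 j).
  set (f3 := fun j => / (2 * z) * (harmonic j * rfact 0 j)).
  set (f4 := fun j => sum_n_m (fun i => clausen_coef i / (2 * z ^ (2 * i + 1)) * rfact (2 * i) j) 1 I).
  set (f5 := fun j => (-1) ^ (j / 2) * PI * Clausen (j + 1) th / th ^ (j + 1)).
  set (f6 := fun j => -1 * (negapolygamma (j + 1) z / z ^ (j + 1))).
  rewrite (weight_ext p m _ (fun j => f1 j + f2 j + f3 j + f4 j + f5 j + f6 j)).
  2:{ intros j Hj. rewrite Rmult_comm. apply (odd_zeta_series_closed_form I j z hz). lia. }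
  rewrite (weight_plus p m (fun j => f1 j + f2 j + f3 j + f4 j + f5 j) f6).
  rewrite (weight_plus p m (fun j => f1 j + f2 j + f3 j + f4 j) f5).
  rewrite (weight_plus p m (fun j => f1 j + f2 j + f3 j) f4).
  rewrite (weight_plus p m (fun j => f1 j + f2 j) f3).
  rewrite (weight_plus p m f1 f2).
  unfold f1, f2, f3, f4, f5, f6. rewrite !weight_scal.
  rewrite weight_rfact_shift, weight_rfact, weight_harmonic by lia.
  unfold I. rewrite weight_zeta_values, weight_clausen, weight_negapolygamma by assumption.
  unfold rhs. fold th.
  match goal with |- context [if ?b then ?x else 0] => set (dl := if b then x else 0) end.
  repeat match goal with |- context [sum_n_m ?a ?b ?c] => generalize (sum_n_m a b c); intro end.
  unfold rfact. simpl Nat.leb. cbv iota. rewrite !Nat.sub_0_r.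
  replace (1 + m + 1)%nat with (m + 2)%nat by lia.
  replace (1 + m + p + 2)%nat with (p + m + 3)%nat by lia.
  replace (th ^ (m + 2)) with (2 * PI * z * th ^ (m + 1))
    by (fold th; replace (m + 2)%nat with (S (m + 1)) by lia; reflexivity).
  pose proof (pow_nonzero th (m + 1) Hth). pose proof (pow_nonzero z (m + 2) Hz0).
  pose proof (INR_fact_pos (m + 1)). pose proof (INR_fact_pos (m + 2)).
  assert (0 < INR (p + m + 2)) by (apply lt_0_INR; lia).
  assert (0 < INR (p + m + 3)) by (apply lt_0_INR; lia).
  simpl (INR 0). simpl (INR 1).
  field. repeat split; try assumption; lra.
Qed.
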